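(* Let $A$ be a unital C*-algebra and $E:A\to B\subseteq A$ a conditional expectation onto a C*-subalgebra $B$ such that $K\cdot E-\mathrm{id}_A$ is positive for some $K\ge 1$. Then there exist a right Hilbert $B$-module $\mathcal{M}$, a $*$-homomorphism $\pi:A\to\mathrm{End}_B(\mathcal{M})$, and a partial isometry $V$ from the Hilbert $B$-module $\{A,E(\langle\cdot,\cdot\rangle_A)\}$ to $\mathcal{M}$ such that $E(a)=V^*\circ\pi(a)\circ V$ for every $a\in A$, and the linear hull of $\{\pi(a_1)(V(a_2)):a_1,a_2\in A\}$ is norm-dense in $\mathcal{M}$.
   Context: A conditional expectation is a norm-one projection onto a C*-subalgebra. $\{A,E(\langle\cdot,\cdot\rangle_A)\}$ denotes $A$ as a right Hilbert $B$-module with inner product $\langle a,b\rangle=E(a^*b)$. $\mathrm{End}_B(\mathcal{M})$ denotes the bounded $B$-linear operators on $\mathcal{M}$. In the identity $E(a)=V^*\pi(a)V$, $E(a)$ is regarded as the $B$-linear operator on $A$ of left multiplication by $E(a)$. *)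

(* Defs.v *)
From HB Require Import structures.
From mathcomp Require Import all_boot all_order all_algebra.
From mathcomp Require Import boolp classical_sets reals.
From mathcomp Require Import complex.
Set Implicit Arguments. Unset Strict Implicit. Unset Printing Implicit Defensive.
Import Order.TTheory GRing.Theory Num.Theory.
Local Open Scope ring_scope.

Definition complete_wrt (R : realType) (V : zmodType) (n : V -> R) : Prop :=
  forall u : nat -> V,
    (forall e : R, 0 < e -> exists N : nat, forall i j : nat,
        (N <= i)%N -> (N <= j)%N -> n (u i - u j) < e) ->
    exists l : V, forall e : R, 0 < e -> exists N : nat, forall i : nat,
        (N <= i)%N -> n (u i - l) < e.

Definition closed_wrt (R : realType) (V : zmodType) (n : V -> R) (P : V -> Prop) : Prop :=
  forall (u : nat -> V) (l : V), (forall i, P (u i)) ->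
    (forall e : R, 0 < e -> exists N : nat, forall i : nat, (N <= i)%N -> n (u i - l) < e) ->
    P l.

Definition cstar_algebra (R : realType) (A : algType R[i])
    (star : A -> A) (nrm : A -> R) : Prop :=
  (((forall a b, star (a + b) = star a + star b)) /\
      ((forall (c : R[i]) a, star (c *: a) = conjc c *: star a)) /\
      ((forall a b, star (a * b) = star b * star a)) /\
      ((forall a, star (star a) = a)) /\
      ((forall a, nrm a = 0 -> a = 0)) /\
      ((forall a b, nrm (a + b) <= nrm a + nrm b)) /\
      ((forall (c : R[i]) a, ((nrm (c *: a))%:C)%C = `|c| * ((nrm a)%:C)%C)) /\
      ((forall a b, nrm (a * b) <= nrm a * nrm b)) /\
      ((forall a, nrm (star a * a) = nrm a ^+ 2)) /\
      (complete_wrt nrm)).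

Definition positive_in (R : realType) (A : algType R[i]) (star : A -> A)
    (P : A -> Prop) (a : A) : Prop :=
  exists z, P z /\ a = star z * z.

Definition positive (R : realType) (A : algType R[i]) (star : A -> A) (a : A) : Prop :=
  positive_in star (fun _ => True) a.

Definition cstar_subalgebra (R : realType) (A : algType R[i])
    (star : A -> A) (nrm : A -> R) (B : A -> Prop) : Prop :=
  ((B 0) /\
      ((forall a b, B a -> B b -> B (a + b))) /\
      ((forall (c : R[i]) a, B a -> B (c *: a))) /\
      ((forall a b, B a -> B b -> B (a * b))) /\
      ((forall a, B a -> B (star a))) /\
      (closed_wrt nrm B)).

(* Conditional expectation: a norm-one (linear) projection E of A onto B.
   The operator norm of E is sup { nrm (E a) | nrm a <= 1 }. *)
Definition cond_expectation (R : realType) (A : algType R[i])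
    (nrm : A -> R) (B : A -> Prop) (E : A -> A) : Prop :=
  (((forall a b, E (a + b) = E a + E b)) /\
      ((forall (c : R[i]) a, E (c *: a) = c *: E a)) /\
      ((forall a, B (E a))) /\
      ((forall b, B b -> E b = b)) /\
      (sup [set nrm (E a) | a in [set a | nrm a <= 1]] = 1)).

Definition hnorm (R : realType) (A : algType R[i]) (nrm : A -> R)
    (M : Type) (ip : M -> M -> A) (x : M) : R :=
  Num.sqrt (nrm (ip x x)).

Definition hilbert_module (R : realType) (A : algType R[i])
    (star : A -> A) (nrm : A -> R) (B : A -> Prop)
    (M : lmodType R[i]) (ract : M -> A -> M) (ip : M -> M -> A) : Prop :=
  (((forall x y b, B b -> ract (x + y) b = ract x b + ract y b)) /\
      ((forall x b b', B b -> B b' -> ract x (b + b') = ract x b + ract x b')) /\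
      ((forall (c : R[i]) x b, B b -> ract (c *: x) b = c *: ract x b
                                  /\ ract x (c *: b) = c *: ract x b)) /\
      ((forall x b b', B b -> B b' -> ract (ract x b) b' = ract x (b * b'))) /\
      ((forall x y, B (ip x y))) /\
      ((forall x y z, ip x (y + z) = ip x y + ip x z)) /\
      ((forall (c : R[i]) x y, ip x (c *: y) = c *: ip x y)) /\
      ((forall x y b, B b -> ip x (ract y b) = ip x y * b)) /\
      ((forall x y, ip y x = star (ip x y))) /\
      ((forall x, positive_in star B (ip x x))) /\
      ((forall x, ip x x = 0 -> x = 0)) /\
      (complete_wrt (hnorm nrm ip))).

Definition is_EndB (R : realType) (A : algType R[i]) (nrm : A -> R)
    (B : A -> Prop) (M : lmodType R[i]) (ract : M -> A -> M) (ip : M -> M -> A)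
    (T : M -> M) : Prop :=
  (((forall x y, T (x + y) = T x + T y)) /\
      ((forall (c : R[i]) x, T (c *: x) = c *: T x)) /\
      ((forall x b, B b -> T (ract x b) = ract (T x) b)) /\
      (exists k : R, forall x, hnorm nrm ip (T x) <= k * hnorm nrm ip x)).

(* pi : A -> End_B(M) is a *-homomorphism; the involution on End_B(M) is the
   module adjoint, so pi (a^* ) = (pi a)^* means <pi(a^* ) x, y> = <x, pi(a) y>. *)
Definition star_hom_EndB (R : realType) (A : algType R[i])
    (star : A -> A) (nrm : A -> R) (B : A -> Prop)
    (M : lmodType R[i]) (ract : M -> A -> M) (ip : M -> M -> A)
    (pi : A -> M -> M) : Prop :=
  (((forall a, is_EndB nrm B ract ip (pi a))) /\
      ((forall a b x, pi (a + b) x = pi a x + pi b x)) /\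
      ((forall (c : R[i]) a x, pi (c *: a) x = c *: pi a x)) /\
      ((forall a b x, pi (a * b) x = pi a (pi b x))) /\
      ((forall a x y, ip (pi (star a) x) y = ip x (pi a y)))).

(* V : {A, E(<.,.>_A)} -> M is a partial isometry of Hilbert B-modules with
   adjoint Vs.  On A the right B-action is right multiplication and the inner
   product is <a, a'> = E(a^* a'). *)
Definition partial_isometry_from_A (R : realType) (A : algType R[i])
    (star : A -> A) (nrm : A -> R) (B : A -> Prop) (E : A -> A)
    (M : lmodType R[i]) (ract : M -> A -> M) (ip : M -> M -> A)
    (V : A -> M) (Vs : M -> A) : Prop :=
  (((forall a a', V (a + a') = V a + V a')) /\
      ((forall (c : R[i]) a, V (c *: a) = c *: V a)) /\
      ((forall a b, B b -> V (a * b) = ract (V a) b)) /\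
      ((exists k : R, forall a,
          hnorm nrm ip (V a) <= k * hnorm nrm (fun x y => E (star x * y)) a)) /\
      ((forall a m, ip (V a) m = E (star a * Vs m))) /\
      ((forall a, V (Vs (V a)) = V a))).

(* Main.v *)
(** The module is the Stinespring space of [E]: the completion of the algebraic
    tensor product of [A] with itself under
    [<a (x) x, a' (x) x'> = E (x^* E (a^* a') x')], with [pi a] acting on the left
    factor and [V x = 1 (x) x].  It is realised as a reproducing kernel space: an
    element [m] is identified with the function [d |-> V^* (pi d)^* m], so that
    [a (x) x] becomes [d |-> E (d^* a) x].

    Positivity of this form over all coefficients [x] in [A] is the complete
    positivity of [E].  For coefficients in [B] it follows from
    [E (b^* a^* a b) = b^* E (a^* a) b], and Gaussian elimination carries it from
    [B] to [A].  The bimodule property of [E] comes from Kadison's inequality,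
    which gives [E (x b + b x) = E x b + b E x]: if [E x = 0], then
    [q b = E (b x)] is a bounded Jordan derivation that vanishes on commutators,
    whence [q u] commutes with [u] and [q (u^n) = n u^(n-1) q u] for unitary [u],
    so [q = 0]. *)
Require Import Defs.
From HB Require Import structures.
From mathcomp Require Import all_boot all_order all_algebra.
From mathcomp Require Import boolp classical_sets functions reals.
From mathcomp Require Import complex.
From mathcomp Require Import ring lra.
From Stdlib Require Ncring Ncring_tac.
Set Implicit Arguments.
Unset Strict Implicit.
Unset Printing Implicit Defensive.
Import Order.TTheory GRing.Theory Num.Theory.
Local Open Scope ring_scope.

(** The module needs an inner product with values in [B], while the kernel form x^* E (a^* a') x'
    takes values in [A]. The completion is carried out for the [A]-valued form, and [E] is composed
    with it only at the end. The constant [K] makes this legitimate: K E p >= p >= 0 gives |E p| <=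
    |p| <= K |E p|, so both forms define equivalent norms, and definiteness and completeness
    survive. The same inequality yields positivity of [E] and, since K E 1 >= 1, places the unit in
    [B]. Spectra and functional calculus are avoided. Positivity is a norm estimate; square roots
    and inverses are fixed points lying in every closed unital subalgebra that contains the given
    element. Applied to commutants this gives the commutation relations, applied to [B] it keeps the
    constructions inside [B]. *)

Section NonCommutativeRing.
Context (S : pzRingType).

(** Connects MathComp rings to the [Ncring] decision procedure, for identities in the noncommutative
    algebra [A]. *)
#[local] Instance nc_ops :
  @Ncring.Ring_ops S 0 1 +%R *%R (fun x y => x - y) -%R eq := {}.

#[local] Instance nc_ring :
  @Ncring.Ring S 0 1 +%R *%R (fun x y => x - y) -%R eq nc_ops.
Proof.
constructor; try exact: RelationClasses.eq_equivalence; try by move=> ? ? -> ? ? ->.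
- by move=> ? ? ->.
- exact: add0r.
- exact: addrC.
- exact: addrA.
- exact: mul1r.
- exact: mulr1.
- exact: mulrA.
- exact: mulrDl.
- by move=> *; exact: mulrDr.
- by [].
- exact: subrr.
Qed.

End NonCommutativeRing.
#[local] Existing Instance nc_ops.
#[local] Existing Instance nc_ring.
Ltac ncring := Ncring_tac.non_commutative_ring.

(** The restriction [e <= 1] lets callers absorb higher powers of [e] into the linear error term. *)
Lemma le_eps (R : realFieldType) (x y D : R) :
  (forall e, 0 < e -> e <= 1 -> x <= y + e * D) -> x <= y.
Proof.
move=> H; rewrite leNgt; apply/negP=> yx.
have D0 : 0 < D by have := H 1 ltr01 (lexx _); lra.
pose e := Num.min 1 ((x - y) / (D *+ 2)).
have e0 : 0 < e by rewrite lt_min ltr01 divr_gt0 ?pmulrn_lgt0 // subr_gt0.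
have e1 : e <= 1 by rewrite ge_min lexx.
have : e <= (x - y) / (D *+ 2) by rewrite ge_min lexx orbT.
rewrite ler_pdivlMr ?pmulrn_lgt0 // => h.
have := H e e0 e1; rewrite mulr2n mulrDr in h; nra.
Qed.

(** * Linear subspaces given by propositional predicates *)

Structure linear_subspace (K : pzRingType) (V : lmodType K) := LinearSubspace {
  lsub :> V -> Prop;
  lsub0 : lsub 0;
  lsubZD : forall c u v, lsub u -> lsub v -> lsub (c *: u + v)
}.

Section SubspaceType.
Context (K : pzRingType) (V : lmodType K) (S : linear_subspace V).

Definition subspace_pred : {pred V} := fun v => `[< S v >].

Fact subspace_pred_closed : submod_closed subspace_pred.
Proof.
split=> [|c u v]; rewrite !unfold_in; first exact/asboolP/lsub0.
by move=> /asboolP Su /asboolP Sv; apply/asboolP/lsubZD.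
Qed.

HB.instance Definition _ :=
  GRing.isSubmodClosed.Build K V subspace_pred subspace_pred_closed.

Definition subspace : Type := {v : V | v \in subspace_pred}.
HB.instance Definition _ := SubType.on subspace.
HB.instance Definition _ := [Choice of subspace by <:].
HB.instance Definition _ := [SubChoice_isSubLmodule of subspace by <:].

Lemma subspaceP (x : subspace) : S (\val x).
Proof. exact/asboolP/(valP x). Qed.

Definition mk_subspace (v : V) (Sv : S v) : subspace := exist _ v (asboolT Sv).

End SubspaceType.

(** * Elementary C*-algebra *)

Section CStar.
Context (R : realType) (A : algType R[i]) (star : A -> A) (nrm : A -> R).
Context (HA : cstar_algebra star nrm).

Lemma starD a b : star (a + b) = star a + star b. Proof. by case: HA. Qed.
Lemma starZ (c : R[i]) a : star (c *: a) = conjc c *: star a.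
Proof. by case: HA => _ []. Qed.
Lemma starM a b : star (a * b) = star b * star a. Proof. by case: HA => _ [_ []]. Qed.
Lemma starK a : star (star a) = a. Proof. by case: HA => _ [_ [_ []]]. Qed.
Lemma nrm0_eq0 a : nrm a = 0 -> a = 0. Proof. case: HA => _ [_ [_ [_ [+ _]]]]; exact. Qed.
Lemma nrmD a b : nrm (a + b) <= nrm a + nrm b.
Proof. by case: HA => _ [_ [_ [_ [_ [+ _]]]]]. Qed.
Lemma nrmZC (c : R[i]) a : ((nrm (c *: a))%:C)%C = `|c| * ((nrm a)%:C)%C.
Proof. by case: HA => _ [_ [_ [_ [_ [_ [+ _]]]]]]. Qed.
Lemma nrmM a b : nrm (a * b) <= nrm a * nrm b.
Proof. by case: HA => _ [_ [_ [_ [_ [_ [_ [+ _]]]]]]]. Qed.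
Lemma nrm_cstar a : nrm (star a * a) = nrm a ^+ 2.
Proof. by case: HA => _ [_ [_ [_ [_ [_ [_ [_ [+ _]]]]]]]]. Qed.
Lemma nrm_complete : complete_wrt nrm.
Proof. by case: HA => _ [_ [_ [_ [_ [_ [_ [_ [_ +]]]]]]]]. Qed.

Lemma star0 : star 0 = 0.
Proof. by rewrite -[X in star X](scale0r 0) starZ conjc0 scale0r. Qed.
Lemma starN a : star (- a) = - star a.
Proof. by apply/eqP; rewrite -addr_eq0 -starD addNr star0. Qed.
Lemma starB a b : star (a - b) = star a - star b.
Proof. by rewrite starD starN. Qed.
Lemma star1 : star 1 = 1.
Proof. by rewrite -[LHS]mulr1 -{2}[1]starK -starM mulr1 starK. Qed.
Lemma star_sum (T : Type) (s : seq T) (F : T -> A) :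
  star (\sum_(i <- s) F i) = \sum_(i <- s) star (F i).
Proof. exact: (big_morph star starD star0). Qed.

Lemma nrmZr (t : R) a : nrm ((t%:C)%C *: a) = `|t| * nrm a.
Proof.
have := nrmZC (t%:C)%C a; rewrite normc_def /= expr0n /= addr0 sqrtr_sqr.
by rewrite -rmorphM /= => -[].
Qed.
Lemma nrmZi a : nrm ('i%C *: a) = nrm a.
Proof.
have := nrmZC 'i%C a; rewrite normc_def /= expr0n /= add0r expr1n sqrtr1.
by rewrite mul1r => -[].
Qed.
Lemma nrm0 : nrm 0 = 0.
Proof. by have := nrmZr 0 0; rewrite normr0 mul0r scaler0. Qed.
Lemma nrmN a : nrm (- a) = nrm a.
Proof. by rewrite -scaleN1r; have := nrmZr (-1) a; rewrite normrN1 mul1r rmorphN rmorph1. Qed.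
Lemma nrm_ge0 a : 0 <= nrm a.
Proof. by have := nrmD a (- a); rewrite subrr nrm0 nrmN; lra. Qed.
Lemma nrmC a b : nrm (a - b) = nrm (b - a).
Proof. by rewrite -nrmN opprB. Qed.
Lemma nrmB a b : nrm (a - b) <= nrm a + nrm b.
Proof. by rewrite -(nrmN b) nrmD. Qed.
Lemma nrm_tri b a c : nrm (a - c) <= nrm (a - b) + nrm (b - c).
Proof. by apply: le_trans (nrmD _ _); rewrite addrA subrK. Qed.
Lemma nrm_star a : nrm (star a) = nrm a.
Proof.
have le x : nrm x <= nrm (star x).
  have := nrmM (star x) x; rewrite nrm_cstar.
  have := nrm_ge0 x; have := nrm_ge0 (star x); nra.
by apply/eqP; rewrite eq_le -{2}(starK a) !le.
Qed.
Lemma nrm1 : nrm 1 = 1.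
Proof.
have := nrm_cstar 1; rewrite star1 mulr1 expr2 => h.
have n0 : nrm 1 != 0 by apply/eqP => /nrm0_eq0/eqP; rewrite oner_eq0.
by apply: (mulfI n0); rewrite mulr1 -h.
Qed.
Lemma nrm_le0 a : nrm a <= 0 -> a = 0.
Proof. by move=> h; apply: nrm0_eq0; apply/eqP; rewrite eq_le h nrm_ge0. Qed.
Lemma nrm_eps a D : (forall e, 0 < e -> e <= 1 -> nrm a <= e * D) -> a = 0.
Proof.
by move=> h; apply: nrm_le0; apply: (@le_eps _ _ _ D) => e e0 e1; rewrite add0r h.
Qed.
Lemma nrm_sqr h : star h = h -> nrm (h * h) = nrm h ^+ 2.
Proof. by move=> hh; rewrite -nrm_cstar hh. Qed.
Lemma star_mul_eq0 z : star z * z = 0 -> z = 0.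
Proof.
move=> h; apply: nrm0_eq0; apply/eqP.
by rewrite -sqrf_eq0 -nrm_cstar h nrm0.
Qed.

(** Scalars are turned into central elements of [A], so that identities involving them become pure
    ring identities. *)
Definition sc (t : R) : A := (t%:C)%C *: 1.

Lemma scE t a : sc t * a = (t%:C)%C *: a.
Proof. by rewrite -scalerAl mul1r. Qed.
Lemma scC t a : sc t * a = a * sc t.
Proof. by rewrite scE -scalerAr mulr1. Qed.
Lemma sc0 : sc 0 = 0. Proof. by rewrite /sc scale0r. Qed.
Lemma sc1 : sc 1 = 1. Proof. by rewrite /sc scale1r. Qed.
Lemma scD s t : sc (s + t) = sc s + sc t.
Proof. by rewrite /sc rmorphD scalerDl. Qed.
Lemma scN t : sc (- t) = - sc t.
Proof. by rewrite /sc rmorphN scaleNr. Qed.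
Lemma scB s t : sc (s - t) = sc s - sc t.
Proof. by rewrite scD scN. Qed.
Lemma scM s t : sc (s * t) = sc s * sc t.
Proof. by rewrite scE /sc scalerA -rmorphM. Qed.
Lemma sc_star t : star (sc t) = sc t.
Proof. by rewrite starZ conjc_real star1. Qed.
Lemma nrm_scM t a : nrm (sc t * a) = `|t| * nrm a.
Proof. by rewrite scE nrmZr. Qed.
Lemma nrm_sc t : nrm (sc t) = `|t|.
Proof. by rewrite nrmZr nrm1 mulr1. Qed.
Lemma scV t a : t != 0 -> sc t * (sc t^-1 * a) = a.
Proof. by move=> t0; rewrite mulrA -scM divff // sc1 mul1r. Qed.
Lemma scVK t a : t != 0 -> sc t^-1 * (sc t * a) = a.
Proof. by move=> t0; rewrite mulrA -scM mulVf // sc1 mul1r. Qed.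
Lemma scMM s t a b : (sc s * a) * (sc t * b) = sc (s * t) * (a * b).
Proof. by rewrite scM mulrA -[sc s * a * _]mulrA -[a * sc t]scC !mulrA. Qed.
Lemma sc_nat n a : sc n%:R * a = a *+ n.
Proof. by rewrite scE rmorph_nat scaler_nat. Qed.

Definition im : A := 'i%C *: 1.
Lemma imC a : im * a = a * im.
Proof. by rewrite -scalerAl mul1r -scalerAr mulr1. Qed.
Lemma imim : im * im = -1.
Proof. by rewrite -scalerAl mul1r scalerA -expr2 sqr_i scaleN1r. Qed.
Lemma imMM a b : (im * a) * (im * b) = - (a * b).
Proof. by rewrite -mulrA [a * (im * b)]mulrA -imC !mulrA imim mulN1r mulNr. Qed.
Lemma im_star : star im = - im.
Proof. by rewrite starZ star1 /im -scaleNr; congr (_ *: _); simpc. Qed.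
Lemma nrm_imM a : nrm (im * a) = nrm a.
Proof. by rewrite -scalerAl mul1r nrmZi. Qed.

(** * Fixed points and closed subalgebras *)

Definition cv (u : nat -> A) l :=
  forall e : R, 0 < e -> exists N : nat, forall i : nat, (N <= i)%N -> nrm (u i - l) < e.

(* Fixed point of [f] by iteration from [0], with increments dominated by those of
   the bounded increasing scalar iteration of [phi]; [f] need not contract. *)
Lemma picard (f : A -> A) (phi : R -> R) (M L : R) :
  0 <= phi 0 -> nrm (f 0) <= phi 0 -> (forall t : R, 0 <= t -> t <= M -> phi t <= M) ->
  (forall y y' (s t : R), 0 <= t -> t <= s -> s <= M -> nrm y <= s -> nrm y' <= t ->
     nrm (y - y') <= s - t -> nrm (f y - f y') <= phi s - phi t) ->
  (forall y y', nrm y <= M -> nrm y' <= M -> nrm (f y - f y') <= L * nrm (y - y')) ->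
  0 <= M ->
  exists y, [/\ f y = y, nrm y <= M &
    forall P, closed_wrt nrm P -> P 0 -> (forall z, P z -> P (f z)) -> P y].
Proof.
move=> phi0 f0 phiM incr lip M0.
pose u n := iter n f 0; pose v n := iter n phi 0.
have step n : [/\ 0 <= v n <= v n.+1, v n.+1 <= M, nrm (u n) <= v n,
   nrm (u n.+1) <= v n.+1 & nrm (u n.+1 - u n) <= v n.+1 - v n].
  elim: n => [|n [/andP[v0 vle] vM un un1 d]].
    by rewrite /u /v /= nrm0 !subr0; split; rewrite ?lexx ?phi0 //; exact: phiM.
  have d' := incr _ _ _ _ v0 vle vM un1 un d.
  have h : v n.+1 <= v n.+2.
    apply: le_trans (_ : phi (v n) <= _) => //; rewrite -subr_ge0.
    exact: le_trans (nrm_ge0 _) d'.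
  split => //; first by rewrite h (le_trans v0 vle).
  - exact: (phiM (v n.+1) (le_trans v0 vle) vM).
  - have := nrmD (u n.+2 - u n.+1) (u n.+1); rewrite subrK.
    move=> h'; apply: le_trans h' _; rewrite -[leRHS](subrK (v n.+1)); exact: lerD.
have mono m n : (m <= n)%N -> v m <= v n /\ nrm (u n - u m) <= v n - v m.
  elim: n => [|n IH]; first by rewrite leqn0 => /eqP->; rewrite !subrr nrm0.
  rewrite leq_eqVlt => /orP[/eqP->|]; first by rewrite !subrr nrm0.
  rewrite ltnS => /IH [h1 h2]; have [/andP[_ h3] _ _ _ h4] := step n.
  by have := nrm_tri (u n) (u n.+1) (u m); split; lra.
have vM n : v n <= M by have [] := step n; lra.
have vc (e : R) : 0 < e -> exists N, forall n, (N <= n)%N -> v n <= v N + e.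
  move=> e0; pose S := (v @` setT)%classic.
  have hs : has_sup S.
    by split; [exists (v 0%N), 0%N | exists M; move=> _ [n _ <-]; exact: vM].
  have [_ [N _ <-] hN] := sup_adherent e0 hs.
  exists N => n _; have : v n <= sup S by apply: ub_le_sup; [case: hs | exists n].
  by lra.
have cau : forall e : R, 0 < e -> exists N : nat, forall i j : nat,
        (N <= i)%N -> (N <= j)%N -> nrm (u i - u j) < e.
  move=> e e0; have [N hN] := vc (e / 3) ltac:(lra).
  exists N => i j Ni Nj; have := nrm_tri (u N) (u i) (u j).
  rewrite [nrm (u N - u j)]nrmC.
  have [_ h1] := mono _ _ Ni; have [_ h2] := mono _ _ Nj.
  by have := hN _ Ni; have := hN _ Nj; lra.
have [y hy] := nrm_complete cau.
have uM n : nrm (u n) <= M by have [] := step n => *; have := vM n; lra.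
have yM : nrm y <= M.
  apply: (@le_eps _ _ _ 1) => e e0 _; have [N /(_ N (leqnn _)) h] := hy e e0.
  have := nrmD (u N) (y - u N); rewrite addrC subrK nrmC.
  by move: (uM N); lra.
exists y; split => //; last first.
  by move=> P cP P0 Pf; apply: (cP u) => // n; elim: n => //= n; exact: Pf.
(* The Lipschitz bound only serves the passage to the limit, so any [L] will do: |f y - y| <= L |y -
   u N| + |u N.+1 - y|. *)
apply/eqP; rewrite -subr_eq0; apply/eqP; apply: (@nrm_eps _ (`|L| + 1)) => e e0 _.
have [N h] := hy e e0.
have h1 := h N (leqnn _); have h2 := h N.+1 (leqnSn _).
have := nrm_tri (u N.+1) (f y) y.
have := lip _ _ yM (uM N); rewrite [nrm (y - _)]nrmC.
have := ler_norm L; have := nrm_ge0 (u N - y).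
have -> : f (u N) = u N.+1 by [].
have := normr_ge0 L.
nra.
Qed.

(** Closure under [star] is left out so that the commutant of an arbitrary single element
    qualifies. *)
Definition closed_subalg (P : A -> Prop) : Prop :=
  [/\ closed_wrt nrm P, P 1, forall a b, P a -> P b -> P (a + b),
      forall c a, P a -> P (c *: a) & forall a b, P a -> P b -> P (a * b)].

Lemma subalg0 P : closed_subalg P -> P 0.
Proof. by case=> _ P1 _ Pz _; rewrite -(scale0r 1); exact: Pz. Qed.
Lemma subalg_sc P t : closed_subalg P -> P (sc t).
Proof. by case=> _ P1 _ Pz _; exact: Pz. Qed.
Lemma subalgB P a b : closed_subalg P -> P a -> P b -> P (a - b).
Proof. by case=> _ _ PD Pz _ Pa Pb; rewrite -scaleN1r; apply: PD => //; exact: Pz. Qed.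

Lemma closed_commutant c : closed_subalg (fun y => c * y = y * c).
Proof.
split.
- move=> u l cu hl; apply/eqP; rewrite -subr_eq0; apply/eqP.
  apply: (@nrm_eps _ (nrm c *+ 2)) => e e0 _; have [N /(_ N (leqnn _)) h] := hl e e0.
  have -> : c * l - l * c = (u N - l) * c - c * (u N - l).
    by rewrite mulrBl mulrBr cu; ncring.
  apply: le_trans (nrmB _ _) _; have := nrmM (u N - l) c; have := nrmM c (u N - l).
  by have := nrm_ge0 c; nra.
- by rewrite mul1r mulr1.
- by move=> a b h1 h2; rewrite mulrDr mulrDl h1 h2.
- by move=> k a h; rewrite -scalerAr -scalerAl h.
- by move=> a b h1 h2; rewrite mulrA h1 -mulrA h2 mulrA.
Qed.

Lemma closed_sa : closed_wrt nrm (fun y => star y = y).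
Proof.
move=> u l su hl; apply/eqP; rewrite -subr_eq0; apply/eqP.
apply: (@nrm_eps _ 2) => e e0 _; have [N /(_ N (leqnn _)) h] := hl e e0.
have -> : star l - l = (u N - l) - star (u N - l).
  by rewrite starB su; ncring.
by apply: le_trans (nrmB _ _) _; rewrite nrm_star; lra.
Qed.

(** * Positive elements *)

(* Positivity of a selfadjoint element read off the norm: the spectrum lies in
   the disc [|t - z| <= t].  Unlike [exists z, a = star z * z], this form is
   visibly stable under sums. *)
Definition pos (a : A) : Prop := star a = a /\ exists t, nrm (sc t - a) <= t.

Lemma pos_sa a : pos a -> star a = a. Proof. by case. Qed.

Lemma posD a b : pos a -> pos b -> pos (a + b).
Proof.
case=> sa [t ta] [sb [s tb]]; split; first by rewrite starD sa sb.
exists (t + s); rewrite scD opprD addrACA.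
by apply: le_trans (nrmD _ _) _; exact: lerD.
Qed.

Lemma pos_scM t a : 0 <= t -> pos a -> pos (sc t * a).
Proof.
move=> t0 [sa [s ta]]; split; first by rewrite starM sc_star sa -scC.
by exists (t * s); rewrite scM -mulrBr nrm_scM ger0_norm // ler_wpM2l.
Qed.

Lemma pos_sc t : 0 <= t -> pos (sc t).
Proof. by move=> t0; split; [exact: sc_star | exists t; rewrite subrr nrm0]. Qed.

Lemma pos0 : pos 0. Proof. by rewrite -sc0; exact: pos_sc. Qed.

Lemma pos_scB t b : star b = b -> nrm b <= t -> pos (sc t - b).
Proof.
move=> sb bt; split; first by rewrite starB sc_star sb.
by exists t; rewrite opprB addrC subrK.
Qed.

(** Write a = t (1 - x) with |x| <= 1. Then (1 - y)^2 = 1 - x is the fixed point equation y = (x +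
    y^2) / 2. When |x| = 1 this is no contraction on the unit ball, but its increments are dominated
    by those of t |-> (1 + t^2) / 2, whose iterates from 0 increase and stay below 1. *)
Lemma pos_sqrt a : pos a ->
  exists s, [/\ pos s, s * s = a & forall P, closed_subalg P -> P a -> P s].
Proof.
case=> sa [t ta]; have := nrm_ge0 (sc t - a) => n0.
have := le_trans n0 ta; rewrite le_eqVlt => /orP[/eqP t0|t0].
  have a0 : a = 0 by apply: nrm_le0; move: ta; rewrite -t0 sc0 sub0r nrmN.
  by exists 0; rewrite a0 mulr0; split; [exact: pos0 | | ].
have tn0 : t != 0 by rewrite gt_eqF.
pose x := 1 - sc t^-1 * a.
have x1 : nrm x <= 1.
  have -> : x = sc t^-1 * (sc t - a) by rewrite mulrBr -scM mulVf // sc1.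
  by rewrite nrm_scM gtr0_norm ?invr_gt0 // mulrC ler_pdivrMr // mul1r.
(* The fixed point of [f] is [1 - sqrt (1 - x)]. *)
pose f y := sc 2^-1 * (x + y * y).
have [y [fy y1 Py]] : exists y, [/\ f y = y, nrm y <= 1 &
    forall P, closed_wrt nrm P -> P 0 -> (forall z, P z -> P (f z)) -> P y].
  have fB z z' : f z - f z' = sc 2^-1 * ((z - z') * z + z' * (z - z')).
    rewrite -mulrBr; congr (_ * _); ncring.
  have fBn z z' : nrm (f z - f z') <= 2^-1 * (nrm (z - z') * (nrm z + nrm z')).
    rewrite fB nrm_scM ger0_norm ?invr_ge0 ?ler0n // ler_pM2l ?invr_gt0 ?ltr0n //.
    apply: le_trans (nrmD _ _) _; rewrite [leRHS]mulrDr; apply: lerD; first exact: nrmM.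
    by rewrite [leRHS]mulrC; exact: nrmM.
  apply: (@picard f (fun t => 2^-1 * (1 + t * t)) 1 1) => //.
  - by rewrite mul0r addr0 mulr1; lra.
  - by rewrite /f !mulr0 !addr0 nrm_scM ger0_norm ?invr_ge0 ?ler0n // mulr1; lra.
  - by move=> s *; nra.
  - move=> z z' s r r0 rs s1 zs zr d; apply: le_trans (fBn _ _) _.
    have -> : 2^-1 * (1 + s * s) - 2^-1 * (1 + r * r) = 2^-1 * ((s - r) * (s + r)) by ring.
    by rewrite ler_pM2l ?invr_gt0 ?ltr0n // ler_pM ?nrm_ge0 ?addr_ge0 ?nrm_ge0 // lerD.
  - move=> z z' zs zr; apply: le_trans (fBn _ _) _; rewrite mul1r.
    by have := nrm_ge0 (z - z'); nra.
have sx : star x = x by rewrite starB star1 starM sc_star sa -scC.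
have sy : star y = y.
  apply: (Py (fun y => star y = y)); [exact: closed_sa | exact: star0 |].
  by move=> z sz; rewrite starM sc_star starD starM sz sx -scC.
have qq : (1 - y) * (1 - y) = 1 - x.
  have h : x + y * y = y + y by rewrite -{3 4}fy -mulr2n -sc_nat scV // pnatr_eq0.
  have -> : (1 - y) * (1 - y) = 1 - (y + y) + y * y by ncring.
  by rewrite -h; ncring.
pose r := Num.sqrt t.
have rr : r * r = t by rewrite -expr2 sqr_sqrtr // ltW.
exists (sc r * (1 - y)); split.
- apply: pos_scM; first exact: sqrtr_ge0.
  by split; [rewrite starB star1 sy | exists 1; rewrite sc1 opprB addrC subrK].
- by rewrite scMM rr qq /x opprB addrC subrK scV.
- move=> P cP Pa; have [c1 P1 PD Pz PM] := cP.
  apply: (PM); first exact: subalg_sc.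
  apply: (subalgB cP) => //; apply: Py => //; first exact: subalg0.
  move=> z Pz'; apply: (PM); first exact: subalg_sc.
  apply: (PD); last exact: PM.
  by apply: (subalgB cP) => //; apply: (PM) => //; exact: subalg_sc.
Qed.

Lemma starM_cartesian a b : star a = a -> star b = b ->
  star (a + im * b) * (a + im * b) = a * a + b * b + im * (a * b - b * a).
Proof.
move=> sa sb; rewrite starD sa starM sb im_star.
have -> : (a + b * - im) * (a + im * b) =
  a * a + a * im * b - b * im * a - b * (im * im) * b by ncring.
by rewrite imim -imC -[b * im]imC; ncring.
Qed.

(** Since [s] and [r] commute, (s + i r)^* (s + i r) = s^2 + r^2 = t, so s + i r and its adjoint s -
    i r both have norm sqrt t; [s] is their average. *)
Lemma commuting_sqr_le s r t : 0 <= t -> star s = s -> star r = r ->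
  s * r = r * s ->  s * s + r * r = sc t -> nrm (s * s) <= t.
Proof.
move=> t0 ss sr c h.
have h1 : nrm (s + im * r) ^+ 2 = `|t|.
  by rewrite -nrm_cstar starM_cartesian // c subrr mulr0 addr0 h nrm_sc.
have h2 : nrm (s + im * r) = nrm (s - im * r).
  by rewrite -nrm_star starD ss starM sr im_star mulrN imC.
have h3 : s + s = (s + im * r) + (s - im * r) by ncring.
have : nrm (s + s) <= nrm (s + im * r) *+ 2 by rewrite h3 mulr2n {2}h2 nrmD.
have -> : s + s = sc 2 * s by rewrite sc_nat mulr2n.
rewrite nrm_scM ger0_norm // mulr2n nrm_sqr // => h4.
rewrite ger0_norm // in h1; have := nrm_ge0 s; nra.
Qed.

(** After scaling to a [k] of norm 1, let r^2 = 1 - k^2. Then r^2 + k^2 = 1 with [r] and [k]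
    commuting, hence |1 - k^2| <= 1, which is the norm criterion for k^2. *)
Lemma pos_sqr h : star h = h -> pos (h * h).
Proof.
move=> sh; have [->|/eqP h0] := pselect (h = 0); first by rewrite mulr0; exact: pos0.
have n0 : 0 < nrm h.
  by rewrite lt_neqAle nrm_ge0 andbT eq_sym; apply: contra h0 => /eqP/nrm0_eq0 ->.
pose k := sc (nrm h)^-1 * h.
have sk : star k = k by rewrite starM sc_star sh -scC.
have k1 : nrm k = 1 by rewrite nrm_scM gtr0_norm ?invr_gt0 // mulVf // gt_eqF.
have [r [pr rr cr]] : exists r, [/\ pos r, r * r = 1 - k * k &
    forall P, closed_subalg P -> P (1 - k * k) -> P r].
  apply: pos_sqrt; rewrite -sc1; apply: pos_scB; first by rewrite starM sk.
  by rewrite nrm_sqr // k1 expr1n.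
have kr : k * r = r * k.
  by apply: (cr _ (closed_commutant k)); ncring.
have : nrm (r * r) <= 1.
  apply: (@commuting_sqr_le r k) => //; first exact: pos_sa.
  by rewrite rr subrK sc1.
rewrite rr => le1.
have : pos (k * k) by split; [rewrite starM sk | exists 1; rewrite sc1].
move/(@pos_scM (nrm h * nrm h)); rewrite mulr_ge0 ?nrm_ge0 // => /(_ isT).
by rewrite -scMM /k scV ?gt_eqF.
Qed.

(** The square roots of [a] and of t - a commute and their squares add up to [t]. *)
Lemma pos_le_norm t a : 0 <= t -> pos a -> pos (sc t - a) -> nrm a <= t.
Proof.
move=> t0 pa pb; have [s [ps ss cs]] := pos_sqrt pa.
have [r [pr rr cr]] := pos_sqrt pb.
rewrite -ss; apply: (@commuting_sqr_le s r) => //; try exact: pos_sa.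
- apply: (cr _ (closed_commutant s)); rewrite mulrBr mulrBl scC; congr (_ - _).
  by rewrite -ss mulrA.
- by rewrite ss rr addrC subrK.
Qed.

(** Makes the existential radius in [pos] explicit: any bound on the norm of a positive element
    serves. *)
Lemma pos_norm_le t a : pos a -> nrm a <= t -> nrm (sc t - a) <= t.
Proof.
move=> pa at'; have t0 := le_trans (nrm_ge0 a) at'.
apply: pos_le_norm => //; first by apply: pos_scB => //; exact: pos_sa.
by rewrite opprB addrC subrK.
Qed.

(** All approximants have norm at most |a| + D, so this single radius works for each of them and
    passes to the limit. *)
Lemma pos_closed a D : (forall e, 0 < e -> e <= 1 -> exists2 p, pos p & nrm (a - p) <= e * D) ->
  pos a.
Proof.
move=> h; split.
  apply/eqP; rewrite -subr_eq0; apply/eqP; apply: (@nrm_eps _ (D + D)) => e e0 e1.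
  have [p pp ap] := h e e0 e1.
  have -> : star a - a = star (a - p) - (a - p) by rewrite starB (pos_sa pp); ncring.
  by apply: le_trans (nrmB _ _) _; rewrite nrm_star mulrDr lerD.
have D0 : 0 <= D by have [p _] := h 1 ltr01 (lexx _); rewrite mul1r; exact: le_trans (nrm_ge0 _).
exists (nrm a + D); apply: (@le_eps _ _ _ D) => e e0 e1.
have [p pp ap] := h e e0 e1.
have h1 : nrm p <= nrm a + D.
  have := nrmB a (a - p); rewrite opprB addrC subrK => h1; nra.
have := nrm_tri p (sc (nrm a + D)) a.
by have := pos_norm_le pp h1; rewrite [nrm (p - a)]nrmC; lra.
Qed.

Lemma norm_mono a b : pos a -> pos (b - a) -> nrm a <= nrm b.
Proof.
move=> pa pb; apply: pos_le_norm => //; first exact: nrm_ge0.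
have sb : star b = b by rewrite -[b](subrK a) starD (pos_sa pa) (pos_sa pb).
have -> : sc (nrm b) - a = (sc (nrm b) - b) + (b - a) by ncring.
by apply: posD => //; exact: pos_scB.
Qed.

Lemma pos_antisym a : pos a -> pos (- a) -> a = 0.
Proof.
move=> pa pb; apply: nrm_le0; rewrite -nrm0; apply: norm_mono => //.
by rewrite sub0r.
Qed.

Lemma nrm_exp2 h n : star h = h -> nrm (h ^+ (2 ^ n)) = nrm h ^+ (2 ^ n).
Proof.
move=> sh; elim: n => [|n IH]; first by rewrite expn0 !expr1.
have sX m : star (h ^+ m) = h ^+ m.
  by elim: m => [|m IHm]; [rewrite expr0 star1 | rewrite exprS starM IHm sh -exprSr exprS].
by rewrite expnS mulnC !exprM !expr2 nrm_sqr // IH expr2.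
Qed.

Lemma nrmX a n : nrm (a ^+ n) <= nrm a ^+ n.
Proof.
elim: n => [|n IH]; first by rewrite !expr0 nrm1.
by rewrite !exprS; apply: le_trans (nrmM _ _) _; rewrite ler_wpM2l ?nrm_ge0.
Qed.

(* [(t + y y^* )^n] differs from [t^n] by [y q y^*] with
   [q = sum_k t^k (t + y^* y)^(n-1-k)], so it grows only linearly in [n] when
   [|t + y^* y| <= t]; along [n = 2^m] this bounds [|t + y y^*|] itself. *)
Lemma pos_opp_swap y : pos (- (star y * y)) -> pos (- (y * star y)).
Proof.
move=> py; pose t := nrm y ^+ 2.
have st x : star (x * star x) = x * star x by rewrite starM starK.
have t0 : 0 <= t by exact: exprn_ge0 (nrm_ge0 _).
pose w := sc t + star y * y; pose v := sc t + y * star y.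
have wt : nrm w <= t.
  have := @pos_norm_le t _ py; rewrite nrmN nrm_cstar opprK; exact.
have sv : star v = v by rewrite starD sc_star st.
split; first by rewrite starN st.
exists t; rewrite opprK -/v.
have wv : y * w = v * y by rewrite /w /v mulrDr mulrDl scC !mulrA.
(* Bounding |q| t rather than |q| avoids the exponent n - 1, and t = |y|^2 is exactly the factor
   that y q y^* contributes. *)
have grow n : exists q, v ^+ n = sc (t ^+ n) + y * q * star y /\ nrm q * t <= n%:R * t ^+ n.
  elim: n => [|n [q [hq nq]]].
    by exists 0; rewrite !expr0 sc1 mulr0 mul0r addr0 nrm0 !mul0r.
  exists (w * q + sc (t ^+ n)); split.
    rewrite exprS hq mulrDr mulrDr mulrDl !mulrA wv.
    rewrite [X in X + _ = _](_ : _ = sc (t ^+ n.+1) + y * sc (t ^+ n) * star y); last first.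
      by rewrite exprS scM /v mulrDl -!mulrA -[star y * sc _]scC.
    by rewrite addrAC addrA.
  have h1 := nrmD (w * q) (sc (t ^+ n)); have h2 := nrmM w q.
  rewrite nrm_sc (ger0_norm (exprn_ge0 n t0)) in h1.
  rewrite -natr1 exprS.
  have h3 : nrm w * nrm q <= t * nrm q by rewrite ler_wpM2r ?nrm_ge0.
  have h4 : nrm (w * q + sc (t ^+ n)) <= t * nrm q + t ^+ n by lra.
  have h5 : (t * nrm q + t ^+ n) * t <= t * (n%:R * t ^+ n) + t ^+ n * t.
    rewrite mulrDl lerD2r -mulrA ler_wpM2l //.
  apply: le_trans (ler_wpM2r t0 h4) _; apply: le_trans h5 _.
  by rewrite le_eqVlt; apply/orP; left; apply/eqP; ring.
have vX n : nrm (v ^+ n) <= t ^+ n * n.+1%:R.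
  have [q [-> nq]] := grow n; apply: le_trans (nrmD _ _) _.
  rewrite nrm_sc (ger0_norm (exprn_ge0 n t0)).
  have h1 := nrmM (y * q) (star y); have h2 := nrmM y q; rewrite nrm_star in h1.
  have h3 : nrm (y * q) * nrm y <= nrm y * nrm q * nrm y by rewrite ler_wpM2r ?nrm_ge0.
  have -> : t ^+ n * n.+1%:R = t ^+ n + n%:R * t ^+ n by rewrite -natr1; ring.
  have h4 : nrm y * nrm q * nrm y = nrm q * t by rewrite /t; ring.
  by rewrite lerD2l; lra.
rewrite leNgt; apply/negP => tv.
have v0 : 0 < nrm v by exact: le_lt_trans tv.
have v2 m : nrm v ^+ (2 ^ m) <= t ^+ (2 ^ m) * (2 ^ m).+1%:R.
  by rewrite -nrm_exp2.
have tp : 0 < t.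
  rewrite lt_neqAle t0 andbT eq_sym; apply: contraTN tv; rewrite sqrf_eq0.
  by move=> /eqP/nrm0_eq0 y0; rewrite /v /t y0 nrm0 expr0n mul0r addr0 sc0 nrm0 ltxx.
(* If |v| = (1 + d) t with d > 0, Bernoulli's inequality gives (1 + 2^m d)^2 <= (1 + d)^(2^(m+1)) <=
   2^(m+1) + 1, quadratic against linear growth in 2^m. *)
pose d := nrm v / t - 1.
have d0 : 0 < d by rewrite subr_gt0 ltr_pdivlMr // mul1r.
have xd : nrm v / t = 1 + d by rewrite /d addrC subrK.
have bern n : 1 + n%:R * d <= (1 + d) ^+ n.
  elim: n => [|n IH]; first by rewrite mul0r addr0.
  rewrite exprS -natr1; have := ler0n R n => n0.
  apply: le_trans (_ : (1 + d) * (1 + n%:R * d) <= _); last by rewrite ler_wpM2l //; lra.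
  have : 0 <= n%:R * d * d by rewrite !mulr_ge0 // ltW.
  by lra.
have key m : (1 + (2 ^ m)%:R * d) ^+ 2 <= 2 * (2 ^ m)%:R + 1.
  apply: le_trans (_ : ((1 + d) ^+ (2 ^ m)) ^+ 2 <= _).
    have := bern (2 ^ m)%N; have : 0 <= (2 ^ m)%:R * d by rewrite mulr_ge0 // ltW.
    by move=> h1 h2; rewrite lerXn2r ?nnegrE //; lra.
  rewrite -exprM mulnC -expnS -xd expr_div_n ler_pdivrMr; last exact: exprn_gt0 tp.
  by have := v2 m.+1; rewrite mulrC expnS -natr1 natrM.
(* For M = 2^m > 3 / d^2 one has M^2 d^2 > 3 M >= 2 M + 1, contradicting [key]. *)
pose B := 3 / (d * d); have B0 : 0 <= B by rewrite divr_ge0 ?mulr_ge0 // ltW.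
have := archi_boundP B0; set m := Num.bound B => Bm.
have : B < (2 ^ m)%:R by apply: lt_trans Bm _; rewrite ltr_nat ltn_expl.
rewrite ltr_pdivrMr ?mulr_gt0 // => h; have := key m.
have : (1 : R) <= (2 ^ m)%:R by rewrite ler1n expn_gt0.
move: h; move: (2 ^ m)%:R => M h M1 h'.
have : 3 * M < M * (d * d) * M by rewrite ltr_pM2r //; lra.
have : 0 <= M * d by rewrite mulr_ge0; lra.
nra.
Qed.

(* With [a = z^* z] and [c = |a| - a], the element [y = z c] has
   [y^* y = - |a| c^2], which forces [y = 0], then [c = 0] and [a = |a|]. *)
Lemma pos_star_mul z : pos (star z * z).
Proof.
set a := star z * z.
have sa : star a = a by rewrite starM starK.
have [m [pm mm cm]] := pos_sqrt (pos_sqr sa).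
have [n [pn nn cn]] := pos_sqrt pm.
have [sm sn] := (pos_sa pm, pos_sa pn).
have am : a * m = m * a by apply: (cm _ (closed_commutant a)); rewrite mulrA.
pose c := m - a.
have sc' : star c = c by rewrite starB sm sa.
have ca : c * a = - (m * c) by rewrite mulrBl mulrBr -mm; ncring.
have cm' : c * m = m * c by rewrite mulrBl mulrBr am.
have cnc : c * n = n * c by apply: (cn _ (closed_commutant c)).
have py : pos (- (star (z * c) * (z * c))).
  have -> : - (star (z * c) * (z * c)) = (n * c) * (n * c).
    rewrite starM sc' -mulrA [star z * _]mulrA -/a mulrA ca -mulNr opprK.
    by rewrite -nn -!mulrA [c * (n * c)]mulrA cnc -!mulrA.
  by apply: pos_sqr; rewrite starM sc' sn cnc.
have pyy : pos (star (z * c) * (z * c)).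
  set y := z * c in py *.
  (* The sum y^* y + y y^* is half a sum of two squares of selfadjoint elements, and - y y^* is
     positive by the swap. *)
  have -> : star y * y = sc 2^-1 * ((y + star y) * (y + star y) +
      (im * (y - star y)) * (im * (y - star y))) + - (y * star y).
    have -> : (y + star y) * (y + star y) + im * (y - star y) * (im * (y - star y)) =
        sc 2 * (star y * y + y * star y).
      by rewrite imMM sc_nat mulr2n; ncring.
    by rewrite scVK ?pnatr_eq0 // addrK.
  apply: posD; last exact: pos_opp_swap.
  apply: pos_scM; first by rewrite invr_ge0 ler0n.
  apply: posD; apply: pos_sqr; first by rewrite starD starK addrC.
  by rewrite starM im_star starB starK imC; ncring.
have zc0 : z * c = 0 by apply: star_mul_eq0; exact: pos_antisym.
have ac0 : a * c = 0 by rewrite -mulrA zc0 mulr0.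
have mc0 : m * c = 0.
  by apply: oppr_inj; rewrite -ca oppr0 -[c * a]starK starM sc' sa ac0 star0.
have c0 : c = 0 by apply: star_mul_eq0; rewrite sc' {1}/c mulrBl mc0 ac0 subrr.
by move/eqP: c0; rewrite subr_eq0 => /eqP <-.
Qed.

Lemma positiveP a : positive star a <-> pos a.
Proof.
split=> [[z [_ ->]]|pa]; first exact: pos_star_mul.
by have [s [ps ss _]] := pos_sqrt pa; exists s; split => //; rewrite (pos_sa ps).
Qed.

Lemma pos_conj c a : pos a -> pos (star c * a * c).
Proof.
move=> pa; have [s [ps <- _]] := pos_sqrt pa.
have -> : star c * (s * s) * c = star (s * c) * (s * c) by rewrite starM (pos_sa ps) !mulrA.
exact: pos_star_mul.
Qed.

Lemma pos_conj_le t a c : star a = a -> nrm a <= t -> pos (sc t * (star c * c) - star c * a * c).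
Proof.
move=> sa at'.
have -> : sc t * (star c * c) - star c * a * c = star c * (sc t - a) * c.
  by rewrite mulrBr mulrBl -[star c * sc t]scC mulrA.
by apply: pos_conj; exact: pos_scB.
Qed.

(** * Inverses and the Cauchy-Schwarz inequality *)

(** With T = |h|, h + e = (T + e) (1 - x) where |x| <= T / (T + e) < 1. The Neumann series of 1 - x
    is obtained as the fixed point of y |-> 1 + y x, inside the ball of radius 1 / (1 - k). *)
Lemma inv_pos h e : pos h -> 0 < e ->
  exists g, [/\ g * (h + sc e) = 1, star g = g & forall P, closed_subalg P -> P h -> P g].
Proof.
move=> ph e0; pose T := nrm h; have T0 : 0 <= T := nrm_ge0 h.
have te : 0 < T + e by rewrite ltr_wpDl.
pose x := sc (T + e)^-1 * (sc T - h).
have hT := pos_norm_le ph (lexx (nrm h)).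
pose k := T / (T + e).
have k0 : 0 <= k by rewrite divr_ge0 // ltW.
have k1 : k < 1 by rewrite ltr_pdivrMr // mul1r ltrDl.
have xk : nrm x <= k.
  by rewrite nrm_scM gtr0_norm ?invr_gt0 // /k mulrC ler_wpM2r // invr_ge0 ltW.
have hx : h + sc e = sc (T + e) * (1 - x).
  rewrite mulrBr mulr1 /x scV ?gt_eqF // scD; ncring.
pose M := (1 - k)^-1; have k1' : 0 < 1 - k by rewrite subr_gt0.
have M0 : 0 <= M by rewrite invr_ge0 ltW.
have kM : 1 + k * M = M.
  by rewrite -[X in X + _](divff (lt0r_neq0 k1')) -mulrDl subrK mul1r.
pose f y := 1 + y * x.
have fB y y' : nrm (f y - f y') <= k * nrm (y - y').
  have -> : f y - f y' = (y - y') * x by rewrite /f; ncring.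
  by apply: le_trans (nrmM _ _) _; rewrite mulrC ler_wpM2r ?nrm_ge0.
have [y [fy _ Py]] : exists y, [/\ f y = y, nrm y <= M &
    forall P, closed_wrt nrm P -> P 0 -> (forall z, P z -> P (f z)) -> P y].
  apply: (@picard f (fun t => 1 + k * t) M k) => //.
  - by rewrite mulr0 addr0.
  - by rewrite /f mul0r mulr0 !addr0 nrm1.
  - by move=> t _ tM; rewrite -[leRHS]kM lerD2l ler_wpM2l.
  - move=> z z' s t _ _ _ _ _ d; apply: le_trans (fB _ _) _.
    have -> : 1 + k * s - (1 + k * t) = k * (s - t) by ring.
    by rewrite ler_wpM2l.
have yx : y * (1 - x) = 1 by rewrite mulrBr mulr1 -{1}fy /f addrK.
have sx : star x = x by rewrite starM sc_star starB sc_star (pos_sa ph) -scC.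
have sy : star y = y.
  have xy : (1 - x) * star y = 1 by rewrite -[LHS]starK starM starK starB star1 sx yx star1.
  by rewrite -[LHS]mul1r -yx -mulrA xy mulr1.
exists (sc (T + e)^-1 * y); split.
- by rewrite hx scMM mulVf ?gt_eqF // sc1 mul1r yx.
- by rewrite starM sc_star sy -scC.
- move=> P cP Ph; have [c1 P1 PD Pz PM] := cP.
  apply: (PM); first exact: subalg_sc.
  apply: Py => //; first exact: subalg0.
  move=> z Pz'; apply: (PD) => //; apply: (PM) => //; apply: (PM); first exact: subalg_sc.
  by apply: (subalgB cP) => //; exact: subalg_sc.
Qed.

(** Put c = - r / t with t >= |p|. Since r^* p r <= t r^* r, the hypothesis gives r^* r / t <= q. As
    [p] may vanish, t = |p| + e is used and [e] tends to 0. *)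
Lemma cauchy_schwarz p q r :
  pos p -> pos q ->
  (forall c, pos (star c * p * c + star c * r + star r * c + q)) ->
  nrm r ^+ 2 <= nrm p * nrm q.
Proof.
move=> pp pq H.
have key t : 0 < t -> nrm p <= t -> nrm r ^+ 2 <= t * nrm q.
  move=> t0 pt; have tn : t != 0 by rewrite gt_eqF.
  have h1 : pos (q - sc t^-1 * (star r * r)).
    have -> : q - sc t^-1 * (star r * r) =
       sc (t^-1 * t^-1) * (sc t * (star r * r) - star r * p * r) +
       (star (- (sc t^-1 * r)) * p * (- (sc t^-1 * r)) + star (- (sc t^-1 * r)) * r
        + star r * - (sc t^-1 * r) + q).
      rewrite starN starM sc_star -!scC.
      have -> : - (sc t^-1 * star r) * p * - (sc t^-1 * r) =
         sc (t^-1 * t^-1) * (star r * p * r).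
        by rewrite -scMM; ncring.
      have -> : star r * - (sc t^-1 * r) = - (sc t^-1 * (star r * r)).
        by rewrite mulrN !mulrA scC.
      have -> : sc (t^-1 * t^-1) * (sc t * (star r * r) - star r * p * r) =
        sc t^-1 * (star r * r) - sc (t^-1 * t^-1) * (star r * p * r).
        by rewrite mulrBr [X in X - _]mulrA -scM -[t^-1 * t^-1 * t]mulrA mulVf // mulr1.
      ncring.
    apply: posD; last exact: H.
    apply: pos_scM; first by rewrite mulr_ge0 // invr_ge0 ltW.
    by apply: pos_conj_le => //; exact: pos_sa.
  have h2 := @norm_mono _ _ (pos_scM (ltW (_ : 0 < t^-1)) (pos_star_mul r)) h1.
  have : nrm (sc t^-1 * (star r * r)) <= nrm q by apply: h2; rewrite invr_gt0.
  by rewrite nrm_scM nrm_cstar gtr0_norm ?invr_gt0 // mulrC ler_pdivrMr // mulrC.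
apply: (@le_eps _ _ _ (nrm q)) => e e0 _; rewrite -mulrDl; apply: key.
- by have := nrm_ge0 p; lra.
- lra.
Qed.

(** * Conditional expectations *)

Context (B : A -> Prop) (E : A -> A) (K : R).
Context (HB : cstar_subalgebra star nrm B) (HE : cond_expectation nrm B E).
Context (K1 : 1 <= K).
Context (HK : forall a, positive star a -> positive star ((K%:C)%C *: E a - a)).

Lemma expD a b : E (a + b) = E a + E b. Proof. by case: HE. Qed.
Lemma expZ c a : E (c *: a) = c *: E a. Proof. by case: HE => _ []. Qed.
Lemma exp_in a : B (E a). Proof. by case: HE => _ [_ []]. Qed.
Lemma exp_id b : B b -> E b = b. Proof. case: HE => _ [_ [_ [+ _]]]; exact. Qed.
Lemma exp0 : E 0 = 0. Proof. by rewrite -[X in E X](scale0r 0) expZ scale0r. Qed.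
Lemma expN a : E (- a) = - E a. Proof. by rewrite -scaleN1r expZ scaleN1r. Qed.
Lemma expB a b : E (a - b) = E a - E b. Proof. by rewrite expD expN. Qed.
Lemma exp_sc t a : E (sc t * a) = sc t * E a. Proof. by rewrite !scE expZ. Qed.
Lemma exp_im a : E (im * a) = im * E a.
Proof. by rewrite -!scalerAl !mul1r expZ. Qed.

Lemma subD a b : B a -> B b -> B (a + b). Proof. case: HB => _ [+ _]; exact. Qed.
Lemma subZ c a : B a -> B (c *: a). Proof. case: HB => _ [_ [+ _]]; exact. Qed.
Lemma subM a b : B a -> B b -> B (a * b). Proof. case: HB => _ [_ [_ [+ _]]]; exact. Qed.
Lemma sub_star a : B a -> B (star a). Proof. case: HB => _ [_ [_ [_ [+ _]]]]; exact. Qed.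

(** * Positivity, contractivity and the unit *)

Lemma exp_pimsner_popa a : pos a -> pos (sc K * E a - a).
Proof. by move=> pa; rewrite scE; apply/positiveP/HK/positiveP. Qed.

Lemma exp_pos a : pos a -> pos (E a).
Proof.
move=> pa; have K0 : 0 < K := lt_le_trans ltr01 K1.
rewrite -(@scVK K (E a)) ?gt_eqF //; apply: pos_scM; first by rewrite invr_ge0 ltW.
by rewrite -[_ * _](subrK a); apply: posD => //; exact: exp_pimsner_popa.
Qed.

(** A selfadjoint h equals ((h + 1)^2 - (h - 1)^2) / 4, a difference of positive elements, whose
    images are positive and hence selfadjoint. *)
Lemma exp_star a : E (star a) = star (E a).
Proof.
have sqr_sa h : star h = h -> star (E (h * h)) = E (h * h).
  by move=> sh; apply: pos_sa; apply: exp_pos; exact: pos_sqr.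
have sa h : star h = h -> star (E h) = E h.
  move=> sh; have -> : h = sc 4^-1 * ((h + 1) * (h + 1) - (h - 1) * (h - 1)).
    have -> : (h + 1) * (h + 1) - (h - 1) * (h - 1) = sc 4 * h.
      by rewrite sc_nat !mulrS mulr0n; ncring.
    by rewrite scVK // pnatr_eq0.
  rewrite exp_sc starM sc_star -scC expB starB.
  by rewrite !sqr_sa // ?starB ?starD star1 sh.
have -> : a = sc 2^-1 * ((a + star a) - im * (im * (a - star a))).
  rewrite mulrA imim mulN1r opprK.
  have -> : a + star a + (a - star a) = sc 2 * a by rewrite sc_nat mulr2n; ncring.
  by rewrite scVK // pnatr_eq0.
set p := a + star a; set q := im * (a - star a).
have sp : star p = p by rewrite /p starD starK addrC.
have sq : star q = q by rewrite /q starM im_star starB starK imC; ncring.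
have st t u v : star u = u -> star v = v -> star (sc t * (u - im * v)) = sc t * (u + im * v).
  by move=> su sv; rewrite starM sc_star -scC starB starM im_star su sv mulrN opprK imC.
by rewrite st // !exp_sc expD expB exp_im st // sa.
Qed.

Lemma exp_nrm a : nrm (E a) <= nrm a.
Proof.
case: HE => _ [_ [_ [_ hs]]].
(* A set without supremum has [sup] equal to 0 by default, so the value 1 forces the set to be
   bounded. *)
have [hsup|/sup_out] := pselect (has_sup [set nrm (E a) | a in [set a | nrm a <= 1]]%classic);
  last by move: hs => -> /eqP; rewrite oner_eq0.
have le1 x : nrm x <= 1 -> nrm (E x) <= 1.
  by move=> x1; rewrite -hs; apply: ub_le_sup; [case: hsup | exists x].
have [->|/eqP a0] := pselect (a = 0); first by rewrite exp0.
have n0 : 0 < nrm a.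
  by rewrite lt_neqAle nrm_ge0 andbT eq_sym; apply: contra a0 => /eqP/nrm0_eq0 ->.
have := le1 (sc (nrm a)^-1 * a).
rewrite exp_sc !nrm_scM gtr0_norm ?invr_gt0 // mulVf ?gt_eqF // => /(_ (lexx _)).
by rewrite mulrC ler_pdivrMr // mul1r.
Qed.

(** As E 1 >= 1 / K, the element x = 1 - E 1 / T has norm below 1. Each 1 - x^n is a polynomial in E
    1 without constant term, so it lies in [B], and it converges to 1. *)
Lemma sub1 : B 1.
Proof.
have K0 : 0 < K := lt_le_trans ltr01 K1.
have [sh [t ht]] : pos (E 1 - sc K^-1).
  have -> : E 1 - sc K^-1 = sc K^-1 * (sc K * E 1 - 1).
    by rewrite mulrBr mulr1 scVK // gt_eqF.
  apply: pos_scM; first by rewrite invr_ge0 ltW.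
  by apply: exp_pimsner_popa; rewrite -sc1; exact: pos_sc.
have t0 : 0 <= t := le_trans (nrm_ge0 _) ht.
have K0' : 0 < K^-1 by rewrite invr_gt0.
pose T := t + K^-1; have T0 : 0 < T by rewrite ltr_wpDl.
pose x := 1 - sc T^-1 * E 1; pose k := t / T.
have xk : nrm x <= k.
  have -> : x = sc T^-1 * (sc t - (E 1 - sc K^-1)).
    have -> : sc t - (E 1 - sc K^-1) = sc T - E 1 by rewrite scD; ncring.
    by rewrite mulrBr -scM mulVf ?gt_eqF // sc1.
  by rewrite nrm_scM gtr0_norm ?invr_gt0 // mulrC ler_wpM2r // invr_ge0 ltW.
have k0 : 0 <= k by rewrite divr_ge0 // ltW.
have k1 : k < 1 by rewrite ltr_pdivrMr // mul1r ltrDl.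
have inB n : B (1 - x ^+ n).
  elim: n => [|n IH]; first by rewrite expr0 subrr; case: HB.
  have -> : 1 - x ^+ n.+1 = (1 - x ^+ n) + sc T^-1 * E 1 + (-1) *: (sc T^-1 * E 1 * (1 - x ^+ n)).
    by rewrite scaleN1r exprS; move: (x ^+ n) => w; rewrite /x; ncring.
  have BE : B (sc T^-1 * E 1) by rewrite scE; apply: subZ; exact: exp_in.
  by apply: subD; [exact: subD | apply: subZ; exact: subM].
have cB : closed_wrt nrm B by case: HB => _ [_ [_ [_ []]]].
apply: (cB (fun n => 1 - x ^+ n)) => // e e0.
(* A Bernoulli estimate giving k^n -> 0 with an explicit rate. *)
have bern n : (n%:R * (1 - k)) * k ^+ n <= 1.
  have : (1 + n%:R * (1 - k)) * k ^+ n <= 1.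
    elim: n => [|n IH]; first by rewrite mul0r addr0 expr0 mulr1.
    apply: le_trans IH; rewrite exprS mulrA ler_wpM2r ?exprn_ge0 // -natr1.
    have := ler0n R n; have : 0 <= n%:R * (1 - k) * (1 - k) by rewrite !mulr_ge0 // subr_ge0 ltW.
    by nra.
  by have := exprn_ge0 n k0; rewrite mulrDl mul1r; lra.
have d0 : 0 < (1 - k) * e by rewrite mulr_gt0 // subr_gt0.
have h0 : 0 <= ((1 - k) * e)^-1 by rewrite invr_ge0 ltW.
exists (Num.bound ((1 - k) * e)^-1) => n hn.
have -> : 1 - x ^+ n - 1 = - (x ^+ n) by ncring.
rewrite nrmN; apply: le_lt_trans (nrmX _ _) _.
apply: le_lt_trans (_ : k ^+ n < e); first by rewrite lerXn2r ?nnegrE ?nrm_ge0.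
have hn' : ((1 - k) * e)^-1 < n%:R.
  by apply: lt_le_trans (archi_boundP h0) _; rewrite ler_nat.
have np : 0 < n%:R :> R by exact: le_lt_trans hn'.
have h1 := bern n.
have h2 : 1 < n%:R * (1 - k) * e by move: hn'; rewrite -[_^-1]mul1r ltr_pdivrMr // mulrA.
have h3 : 0 < n%:R * (1 - k) by rewrite mulr_gt0 // subr_gt0.
by rewrite -(ltr_pM2l h3); apply: le_lt_trans h1 _.
Qed.

Lemma exp1 : E 1 = 1. Proof. by apply: exp_id; exact: sub1. Qed.

Lemma closed_subalg_sub : closed_subalg B.
Proof.
split; [by case: HB => _ [_ [_ [_ []]]] | exact: sub1 | exact: subD | exact: subZ | exact: subM].
Qed.

Lemma cartesian w : exists u v, [/\ star u = u, star v = v, w = u + im * v &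
  B w -> B u /\ B v].
Proof.
exists (sc 2^-1 * (w + star w)), (sc 2^-1 * (- (im * (w - star w)))); split.
- by rewrite starM sc_star -scC starD starK [star w + _]addrC.
- by rewrite starM sc_star -scC starN starM im_star starB starK imC; congr (_ * _); ncring.
- rewrite [im * _]mulrA imC -mulrA mulrN [im * (im * _)]mulrA imim mulN1r opprK -mulrDr.
  have -> : w + star w + (w - star w) = sc 2 * w by rewrite sc_nat mulr2n; ncring.
  by rewrite scVK // pnatr_eq0.
- move=> Bw; have Bs := sub_star Bw.
  rewrite !scE -!scalerAl !mul1r; split; apply: subZ; first exact: subD.
  by rewrite -scaleN1r; apply: subZ; apply: subZ; rewrite -scaleN1r; apply: subD; last exact: subZ.
Qed.

(** * From Kadison's inequality to the bimodule property *)

(* [z = 1 + i e y - e^2 y^2 / 2] satisfies [z^* z = 1 + e^4 y^4 / 4], so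
   [|E z|^2 <= 1 + O(e^4)], while [(E z)^* (E z) = 1 - e^2 (E (y^2) - (E y)^2) + O(e^3)]. *)
Lemma kadison y : star y = y -> pos (E (y * y) - E y * E y).
Proof.
move=> sy; set S := E (y * y); set m := E y.
have sm : star m = m by rewrite -exp_star sy.
have sS : star S = S by rewrite -exp_star starM sy.
have [C C0 CE] : exists2 C, 0 <= C & C = (nrm (y * y) / 2) ^+ 2.
  by exists ((nrm (y * y) / 2) ^+ 2); rewrite ?exprn_even_ge0.
apply: (@pos_closed _ (C + nrm S * nrm S + nrm m * nrm S)) => e e0 e1.
(* The terms of order e^3 and e^4 in t - (E z)^* E z, divided by e^2; here e^4 C is the excess over
   1 in the bound on |z|^2. *)
pose W := sc (e ^+ 2 * C) - sc (e ^+ 2 / 4) * (S * S) - im * (sc (e / 2) * (m * S - S * m)).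
exists (S - m * m + W); last first.
  rewrite opprD addrA subrr sub0r nrmN.
  apply: le_trans (nrmB _ _) _; rewrite nrm_imM nrm_scM ger0_norm ?divr_ge0 ?(ltW e0) //.
  have h1 := nrmB (sc (e ^+ 2 * C)) (sc (e ^+ 2 / 4) * (S * S)).
  rewrite nrm_sc nrm_scM !ger0_norm ?divr_ge0 ?mulr_ge0 ?exprn_ge0 ?(ltW e0) // in h1.
  have h2 : e / 2 * nrm (m * S - S * m) <= e / 2 * (2 * (nrm m * nrm S)).
    rewrite ler_wpM2l ?divr_ge0 ?(ltW e0) //; apply: le_trans (nrmB _ _) _.
    by have := nrmM m S; have := nrmM S m; lra.
  have h3 : e ^+ 2 / 4 * nrm (S * S) <= e * (nrm S * nrm S).
    apply: ler_pM; rewrite ?divr_ge0 ?exprn_ge0 ?nrm_ge0 ?nrmM ?(ltW e0) //.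
    by rewrite expr2; nra.
  have h4 : e ^+ 2 * C <= e * C by rewrite ler_wpM2r // expr2; nra.
  by lra.
pose P := sc (e ^+ 2 / 2) * (y * y); pose Y := sc e * y.
pose z := (1 - P) + im * Y.
have sP : star P = P by rewrite starM sc_star starM sy -scC.
have sY : star Y = Y by rewrite starM sc_star sy -scC.
have PY : P * Y = Y * P by rewrite /P /Y !scMM [e ^+ 2 / 2 * e]mulrC !mulrA.
have YY : Y * Y = P + P by rewrite scMM -mulrDl -scD; congr (sc _ * _); field.
pose t := 1 + e ^+ 4 * C.
have nz : nrm z ^+ 2 <= t.
  rewrite -nrm_cstar starM_cartesian ?starB ?star1 ?sP //.
  have -> : (1 - P) * (1 - P) + Y * Y + im * ((1 - P) * Y - Y * (1 - P)) = 1 + P * P.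
    have -> : (1 - P) * Y - Y * (1 - P) = 0 by rewrite mulrBl mulrBr PY; ncring.
    by rewrite YY mulr0; ncring.
  apply: le_trans (nrmD _ _) _; rewrite nrm1 lerD2l; apply: le_trans (nrmM _ _) _.
  rewrite nrm_scM ger0_norm ?divr_ge0 ?exprn_ge0 ?(ltW e0) //.
  by rewrite le_eqVlt; apply/orP; left; apply/eqP; rewrite CE; field.
have Ez : E z = (1 - sc (e ^+ 2 / 2) * S) + im * (sc e * m).
  by rewrite expD expB exp1 exp_im !exp_sc.
have h : pos (sc t - star (E z) * E z).
  apply: pos_scB; first by rewrite starM starK.
  rewrite nrm_cstar; apply: le_trans nz.
  by rewrite lerXn2r ?nnegrE ?nrm_ge0 // exp_nrm.
have -> : S - m * m + W = sc (e ^+ 2)^-1 * (sc t - star (E z) * E z); last first.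
  by apply: pos_scM => //; rewrite invr_ge0 exprn_ge0 // ltW.
have e2 : e ^+ 2 != 0 by rewrite expf_neq0 // gt_eqF.
apply: (can_inj (fun a => @scVK _ a e2)); rewrite scV // Ez.
set p := sc (e ^+ 2 / 2) * S; set b := sc e * m.
have sp : star p = p by rewrite starM sc_star sS -scC.
have sb : star b = b by rewrite starM sc_star sm -scC.
rewrite starM_cartesian ?starB ?star1 ?sp //.
have -> : (1 - p) * (1 - p) + b * b + im * ((1 - p) * b - b * (1 - p)) =
  1 - (p + p) + p * p + b * b + im * (b * p - p * b) by ncring.
have -> : p + p = sc (e ^+ 2) * S by rewrite /p -mulrDl -scD; congr (sc _ * _); field.
have -> : p * p = sc (e ^+ 4 / 4) * (S * S) by rewrite scMM; congr (sc _ * _); field.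
have -> : b * b = sc (e ^+ 2) * (m * m) by rewrite scMM.
have -> : b * p - p * b = sc (e ^+ 2) * (sc (e / 2) * (m * S - S * m)).
  by rewrite !scMM [in RHS]mulrA -scM [_ / 2 * e]mulrC -mulrBr; congr (sc _ * _); field.
have -> : sc (e ^+ 2) * (S - m * m + W) = sc (e ^+ 2) * S - sc (e ^+ 2) * (m * m) +
    (sc (t - 1) - sc (e ^+ 4 / 4) * (S * S) - im * (sc (e ^+ 2) * (sc (e / 2) * (m * S - S * m)))).
  rewrite [LHS]mulrDr [sc _ * (S - _)]mulrBr; congr (_ + _).
  rewrite /W [LHS]mulrBr [sc _ * (sc _ - _)]mulrBr; congr (_ - _ - _).
  - by apply: etrans (esym (scM _ _)) _; congr sc; rewrite /t; ring.
  - by rewrite [LHS]mulrA -scM; congr (sc _ * _); field.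
  - by rewrite [LHS]mulrA -imC -mulrA.
by rewrite scB sc1; ncring.
Qed.

(** Apply Kadison's inequality to e a + c with [c] in [B]. The c^2 terms cancel; division by [e] and
    e -> 0 show that the defect [T c] is positive. As [T] is odd, it vanishes. *)
Lemma jordan_sa a b : star a = a -> star b = b -> B b ->
  E (a * b + b * a) = E a * b + b * E a.
Proof.
move=> sa; set T := fun b => E (a * b + b * a) - (E a * b + b * E a).
have half c : star c = c -> B c -> pos (T c).
  move=> sc' Bc; apply: (@pos_closed _ (nrm (E (a * a) - E a * E a))) => e e0 _.
  exists (T c + sc e * (E (a * a) - E a * E a)); last first.
    by rewrite opprD addrA subrr sub0r nrmN nrm_scM gtr0_norm.
  rewrite -(@scVK e (T c + _)) ?gt_eqF //; apply: pos_scM; first by rewrite invr_ge0 ltW.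
  suff -> : sc e * (T c + sc e * (E (a * a) - E a * E a)) =
     E ((sc e * a + c) * (sc e * a + c)) - E (sc e * a + c) * E (sc e * a + c).
    by apply: kadison; rewrite starD starM sc_star sa sc' -scC.
  have -> : (sc e * a + c) * (sc e * a + c) =
     sc (e * e) * (a * a) + sc e * (a * c + c * a) + c * c.
    rewrite -scMM [in RHS]mulrDr [sc e * (c * a)]mulrA [sc e * c]scC; ncring.
  have -> : E (sc e * a + c) = sc e * E a + c by rewrite expD exp_sc (exp_id Bc).
  have -> : (sc e * E a + c) * (sc e * E a + c) =
     sc (e * e) * (E a * E a) + sc e * (E a * c + c * E a) + c * c.
    rewrite -scMM [in RHS]mulrDr [sc e * (c * E a)]mulrA [sc e * c]scC; ncring.
  rewrite [E (_ + _ + _)]expD [E (_ + sc e * _)]expD !exp_sc (exp_id (subM Bc Bc)) /T.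
  by rewrite scM; ncring.
move=> sb Bb; apply/eqP; rewrite -subr_eq0; apply/eqP.
apply: pos_antisym; first exact: half.
have -> : - (E (a * b + b * a) - (E a * b + b * E a)) = T (- b).
  by rewrite /T !mulrN !mulNr -!opprD expN; ncring.
by apply: half; rewrite ?starN ?sb // -scaleN1r; exact: subZ.
Qed.

Lemma jordan w b : B b -> E (w * b + b * w) = E w * b + b * E w.
Proof.
have imr u c : (u * (im * c) = im * (u * c)) * (im * u * c = im * (u * c)).
  by split; [rewrite mulrA -imC -mulrA | rewrite -mulrA].
have [u [v [su sv -> _]]] := cartesian w.
have [b1 [b2 [s1 s2 -> Bb12]]] := cartesian b.
move=> /Bb12 [B1 B2].
have -> : (u + im * v) * (b1 + im * b2) + (b1 + im * b2) * (u + im * v) =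
  (u * b1 + b1 * u) + im * (v * b1 + b1 * v) + im * (u * b2 + b2 * u)
  + im * (im * (v * b2 + b2 * v)).
  by rewrite !(mulrDl, mulrDr, imr); ncring.
have expDi x y z t : E (x + im * y + im * z + im * (im * t)) =
    E x + im * E y + im * E z + im * (im * E t) by rewrite !expD !exp_im.
rewrite expDi !jordan_sa // !expD exp_im.
by rewrite !(mulrDl, mulrDr, imr); ncring.
Qed.

Lemma exp_mull_unitary x u : E x = 0 -> B u -> B (star u) -> star u * u = 1 -> E (u * x) = 0.
Proof.
move=> Ex Bu _ uu; pose q b := E (b * x).
have qD b c : q (b + c) = q b + q c by rewrite /q mulrDl expD.
have qN b : q (- b) = - q b by rewrite /q mulNr expN.
(* E (c x b) is eliminated between the Jordan identities for the pairs (c x, b) and (x b, c). The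
   result is symmetric in [b] and [c], which makes [q] vanish on commutators. *)
have q2 b c : B b -> B c ->
    q (b * c) + q (b * c) = b * q c + q c * b + q b * c + c * q b.
  move=> Bb Bc.
  have h1 : E (x * (b * c)) = - q (b * c).
    by apply/eqP; rewrite -addr_eq0 -expD jordan ?Ex ?mul0r ?mulr0 ?addr0 //; exact: subM.
  have h1b : E (x * b) = - q b.
    by apply/eqP; rewrite -addr_eq0 -expD jordan ?Ex ?mul0r ?mulr0 ?addr0.
  have h2 := jordan (c * x) Bb; rewrite expD mulrA -/(q _) -/(q c) in h2.
  have h3 := jordan (x * b) Bc.
  rewrite expD -mulrA h1 mulrA h1b in h3.
  have h2' : E (c * x * b) = q c * b + b * q c - q (b * c) by rewrite -h2 addrK.
  rewrite h2' in h3.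
  have -> : q (b * c) + q (b * c) =
      b * q c + q c * b - (- q (b * c) + (q c * b + b * q c - q (b * c))).
    by ncring.
  by rewrite h3 mulNr mulrN; ncring.
have two0 (a : A) : a + a = 0 -> a = 0.
  by rewrite -mulr2n -sc_nat => h; rewrite -(@scVK 2 a) ?pnatr_eq0 // h mulr0.
have two_inj (a b : A) : a + a = b + b -> a = b.
  by move=> h; apply/eqP; rewrite -subr_eq0; apply/eqP/two0; rewrite addrACA -opprD h subrr.
have qC b c : B b -> B c -> q (b * c) = q (c * b).
  by move=> Bb Bc; apply: two_inj; rewrite !q2 //; ncring.
have BN b : B b -> B (- b) by move=> Bb; rewrite -scaleN1r; exact: subZ.
have Bcom b c : B b -> B c -> B (b * c - c * b).
  by move=> Bb Bc; apply: subD; [exact: subM | apply: BN; exact: subM].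
have qcom b c : B b -> B c -> q (b * c - c * b) = 0.
  by move=> Bb Bc; rewrite qD qN (qC b) // subrr.
set Q := q u; have BQ : B Q by exact: exp_in.
(* For k = u c - c u, both [k] and k u = u (c u) - (c u) u are commutators, so [q2] applied to [k]
   and [u] leaves only k Q + Q k = 0. *)
have anti c : B c -> Q * (u * c - c * u) + (u * c - c * u) * Q = 0.
  move=> Bc; have Bk := Bcom _ _ Bu Bc.
  have := q2 _ _ Bk Bu; rewrite (qcom u c) // mul0r mulr0 !addr0.
  have -> : (u * c - c * u) * u = u * (c * u) - (c * u) * u by ncring.
  by rewrite (qcom _ _ Bu (subM Bc Bu)) addr0 => h; rewrite addrC -h.
(* Compare [anti] for c u with [anti] for [c] multiplied by [u] on the right. *)
have ann c : B c -> (u * c - c * u) * (u * Q - Q * u) = 0.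
  move=> Bc; have h1 := anti (c * u) (subM Bc Bu); have h2 := anti c Bc.
  have -> : (u * c - c * u) * (u * Q - Q * u) =
     (Q * (u * (c * u) - c * u * u) + (u * (c * u) - c * u * u) * Q)
     - (Q * (u * c - c * u) + (u * c - c * u) * Q) * u by ncring.
  by rewrite h1 h2 mul0r subr0.
set W := u * Q - Q * u in ann.
have ann2 c d : B c -> B d -> (u * c - c * u) * d * W = 0.
  move=> Bc Bd.
  have -> : (u * c - c * u) * d * W =
    (u * (c * d) - c * d * u) * W - c * ((u * d - d * u) * W) by ncring.
  by rewrite !ann // ?mulr0 ?subr0 //; exact: subM.
have BW : B W by exact: Bcom.
have W0 : W = 0.
  (* With c = Q the commutator is [W] itself, so W W^* W = 0. *)
  have := ann2 Q (star W) BQ (sub_star BW); rewrite -/W => h.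
  apply: star_mul_eq0; apply: star_mul_eq0.
  by rewrite starM starK -mulrA [W * (_ * _)]mulrA h mulr0.
have uQ : u * Q = Q * u by apply/eqP; rewrite -subr_eq0; apply/eqP.
have BX n : B (u ^+ n).
  by elim: n => [|n IH]; [rewrite expr0; exact: sub1 | rewrite exprS; exact: subM].
have uXQ n : u ^+ n * Q = Q * u ^+ n.
  elim: n => [|n IH]; first by rewrite expr0 mul1r mulr1.
  by rewrite exprS -mulrA IH !mulrA uQ.
have qX n : q (u ^+ n.+1) = sc n.+1%:R * (u ^+ n * Q).
  elim: n => [|n IH]; first by rewrite expr1 expr0 mul1r sc1 mul1r.
  apply: two_inj; rewrite exprS q2 // IH.
  have -> : u * (sc n.+1%:R * (u ^+ n * Q)) = sc n.+1%:R * (u ^+ n.+1 * Q).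
    by rewrite mulrA -scC -mulrA exprS !mulrA.
  have -> : sc n.+1%:R * (u ^+ n * Q) * u = sc n.+1%:R * (u ^+ n.+1 * Q).
    by rewrite -mulrA -mulrA -uQ exprSr !mulrA.
  by rewrite -uXQ -[n.+2%:R]natr1 scD sc1; ncring.
have nX n : nrm (u ^+ n * Q) = nrm Q.
  elim: n => [|n IH]; first by rewrite expr0 mul1r.
  have iso a : nrm (u * a) = nrm a.
    apply/eqP; rewrite -(@eqrXn2 _ 2) ?nrm_ge0 // -!nrm_cstar starM -mulrA.
    by rewrite [star u * _]mulrA uu mul1r.
  by rewrite exprS -mulrA iso.
have nuX n : nrm (u ^+ n) = 1.
  elim: n => [|n IH]; first by rewrite expr0 nrm1.
  apply/eqP; rewrite -(@eqrXn2 _ 2) ?nrm_ge0 // -nrm_cstar exprS starM -mulrA.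
  by rewrite [star u * _]mulrA uu mul1r nrm_cstar IH.
apply: nrm_le0; rewrite -/(q u) -/Q leNgt; apply/negP => Q0.
have b n : n.+1%:R * nrm Q <= nrm x.
  have := exp_nrm (u ^+ n.+1 * x); rewrite -/(q _) qX nrm_scM nX ger0_norm ?ler0n // => h.
  by apply: le_trans h _; apply: le_trans (nrmM _ _) _; rewrite nuX mul1r.
have h0 : 0 <= nrm x / nrm Q by rewrite divr_ge0 ?nrm_ge0.
have := archi_boundP h0; rewrite ltr_pdivrMr // => h.
have := b (Num.bound (nrm x / nrm Q)); rewrite -natr1 mulrDl.
by move: h Q0; set m := _%:R * _; lra.
Qed.

(** A selfadjoint contraction h in [B] is the average of the unitaries h + i r and h - i r with r^2
    = 1 - h^2. They lie in [B] because the root lies in every closed unital subalgebra containing 1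
    - h^2. *)
Lemma exp_mull b a : B b -> E (b * a) = b * E a.
Proof.
move=> Bb; set x := a - E a.
have Ex : E x = 0 by rewrite expB (exp_id (exp_in a)) subrr.
suff ker c : B c -> E (c * x) = 0.
  have := ker b Bb; rewrite mulrBr expB [E (b * E a)]exp_id; last exact: subM (exp_in a).
  by move/eqP; rewrite subr_eq0 => /eqP.
have small h : star h = h -> nrm h <= 1 -> B h -> E (h * x) = 0.
  move=> sh h1 Bh.
  have [r [pr rr Pr]] : exists r, [/\ pos r, r * r = 1 - h * h &
      forall P, closed_subalg P -> P (1 - h * h) -> P r].
    apply: pos_sqrt; rewrite -sc1; apply: pos_scB; first by rewrite starM sh.
    by rewrite nrm_sqr // expr_le1 // nrm_ge0.
  have sr := pos_sa pr.
  have hr : h * r = r * h by apply: (Pr _ (closed_commutant h)); ncring.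
  have Br : B r.
    apply: (Pr _ closed_subalg_sub); apply: (subalgB closed_subalg_sub).
      exact: sub1.
    exact: subM.
  have Bi d : B d -> B (im * d) by move=> Bd; rewrite -scalerAl mul1r; exact: subZ.
  have BN d : B d -> B (- d) by move=> Bd; rewrite -scaleN1r; exact: subZ.
  have Bu : B (h + im * r) by apply: subD => //; exact: Bi.
  have Bv : B (h + im * - r) by apply: subD => //; apply/Bi/BN.
  have hu : E ((h + im * r) * x) = 0.
    apply: exp_mull_unitary => //; first exact: sub_star.
    by rewrite starM_cartesian // hr subrr mulr0 addr0 rr addrC subrK.
  have hv : E ((h + im * - r) * x) = 0.
    apply: exp_mull_unitary => //; first exact: sub_star.
    rewrite starM_cartesian ?starN ?sr // !mulrN !mulNr !opprK hr addNr mulr0 addr0.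
    by rewrite rr addrC subrK.
  have : E ((h + im * r) * x) + E ((h + im * - r) * x) = 0 by rewrite hu hv addr0.
  rewrite -expD -mulrDl.
  have -> : h + im * r + (h + im * - r) = sc 2 * h by rewrite sc_nat mulr2n; ncring.
  rewrite -mulrA exp_sc => h0; rewrite -(@scVK 2 (E (h * x))) ?pnatr_eq0 //.
  by rewrite h0 mulr0.
have sa h : star h = h -> B h -> E (h * x) = 0.
  move=> sh Bh; pose t := nrm h + 1; have t0 : 0 < t by rewrite ltr_wpDl ?nrm_ge0.
  rewrite -(@scV t h) ?gt_eqF // -mulrA exp_sc small ?mulr0 //.
  - by rewrite starM sc_star sh -scC.
  - by rewrite nrm_scM gtr0_norm ?invr_gt0 // mulrC ler_pdivrMr // mul1r /t; lra.
  - by rewrite scE; exact: subZ.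
move=> Bc; have [u [v [su sv cE Buv]]] := cartesian c.
have [Bu Bv] := Buv Bc.
by rewrite cE mulrDl expD -mulrA exp_im !sa // mulr0 addr0.
Qed.

Lemma exp_mulr b a : B b -> E (a * b) = E a * b.
Proof.
move=> Bb; rewrite -[RHS]starK starM -exp_star -exp_mull; last exact: sub_star.
by rewrite -starM exp_star starK.
Qed.

(** * Positive kernels and their Hilbert modules *)

Section Lists.
Context (T : Type).
Implicit Types (k : T -> T -> A) (s t : seq (T * A)) (f g : T -> A).

(* A list [s] of pairs [(a, x)] stands for [sum a (x) x]; [ev k s] is the function
   it represents, and [pr s f] its inner product with [f]. *)
Definition ev k s (d : T) : A := \sum_(q <- s) k d q.1 * q.2.
Definition pr s f : A := \sum_(p <- s) star p.2 * f p.1.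
Definition smul s (c : A) : seq (T * A) := [seq (q.1, q.2 * c) | q <- s].

Lemma ev_nil k d : ev k [::] d = 0. Proof. exact: big_nil. Qed.
Lemma ev_cons k q s d : ev k (q :: s) d = k d q.1 * q.2 + ev k s d.
Proof. by rewrite /ev big_cons. Qed.
Lemma pr_nil f : pr [::] f = 0. Proof. exact: big_nil. Qed.
Lemma pr_cons q s f : pr (q :: s) f = star q.2 * f q.1 + pr s f.
Proof. by rewrite /pr big_cons. Qed.
Lemma ev_cat k s t d : ev k (s ++ t) d = ev k s d + ev k t d.
Proof. by rewrite /ev big_cat. Qed.
Lemma pr_cat s t f : pr (s ++ t) f = pr s f + pr t f.
Proof. by rewrite /pr big_cat. Qed.
Lemma ev_smul k s c d : ev k (smul s c) d = ev k s d * c.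
Proof. by rewrite /ev big_map mulr_suml; apply: eq_bigr => q _; rewrite mulrA. Qed.
Lemma pr_smul s c f : pr (smul s c) f = star c * pr s f.
Proof. by rewrite /pr big_map mulr_sumr; apply: eq_bigr => q _; rewrite starM mulrA. Qed.
Lemma prD s f g : pr s (fun d => f d + g d) = pr s f + pr s g.
Proof. by rewrite /pr -big_split; apply: eq_bigr => q _; rewrite mulrDr. Qed.
Lemma prB s f g : pr s (fun d => f d - g d) = pr s f - pr s g.
Proof. by rewrite /pr -sumrB; apply: eq_bigr => q _; rewrite mulrBr. Qed.
Lemma pr_mulr s f c : pr s (fun d => f d * c) = pr s f * c.
Proof. by rewrite /pr mulr_suml; apply: eq_bigr => q _; rewrite mulrA. Qed.
Lemma eq_pr s f g : f =1 g -> pr s f = pr s g.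
Proof. by move=> fg; apply: eq_bigr => q _; rewrite fg. Qed.

Lemma pr_ev_star k s t : (forall i j, star (k i j) = k j i) ->
  star (pr s (ev k t)) = pr t (ev k s).
Proof.
move=> kh; rewrite /pr /ev star_sum.
under eq_bigr => p _ do rewrite starM starK star_sum mulr_suml.
rewrite exchange_big /=; apply: eq_bigr => q _; rewrite mulr_sumr.
by apply: eq_bigr => p _; rewrite starM kh mulrA.
Qed.

Definition coefs_in s : Prop := foldr (fun p P => B p.2 /\ P) True s.

Lemma ev_in k s d : (forall i j, B (k i j)) -> coefs_in s -> B (ev k s d).
Proof.
move=> kB; elim: s => [_|q s IH [Bq Bs]]; first by rewrite /ev big_nil; case: HB.
by rewrite ev_cons; apply: subD; [exact: subM | exact: IH].
Qed.

(* One step of Gaussian elimination: completing the square in the coefficient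
   of the first entry replaces [k] by its Schur complement, which is positive
   on [B] again because the eliminated coefficient lies in [B].  The shift by
   [e] makes the pivot [k i i] invertible. *)
Lemma kernel_pos k s : (forall i j, star (k i j) = k j i) -> (forall i j, B (k i j)) ->
  (forall t, coefs_in t -> pos (pr t (ev k t))) -> pos (pr s (ev k s)).
Proof.
elim: s k => [|[i x] s IH] k kh kB kp; first by rewrite /pr big_nil; exact: pos0.
have pk : pos (k i i).
  have := kp [:: (i, 1)]; rewrite pr_cons ev_cons /pr /ev !big_nil !addr0 /= star1 mul1r mulr1.
  by apply; split => //; exact: sub1.
apply: (@pos_closed _ (nrm (star x * x))) => e e0 _.
exists (pr ((i, x) :: s) (ev k ((i, x) :: s)) + sc e * (star x * x)); last first.
  by rewrite opprD addrA subrr sub0r nrmN nrm_scM gtr0_norm.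
have [g [gh sg gB]] := inv_pos pk e0.
have hg : (k i i + sc e) * g = 1.
  by rewrite -[LHS]starK starM sg starD (pos_sa pk) sc_star gh star1.
have Bg : B g := gB _ closed_subalg_sub (kB i i).
pose k' a b := k a b - k a i * g * k i b.
have expand y t : pr ((i, y) :: t) (ev k ((i, y) :: t)) + sc e * (star y * y) =
    star (y + g * ev k t i) * (k i i + sc e) * (y + g * ev k t i) + pr t (ev k' t).
  rewrite pr_cons ev_cons /=; set v := ev k t i.
  have -> : pr t (ev k ((i, y) :: t)) = star v * y + pr t (ev k t).
    rewrite (@eq_pr _ _ (fun d => k d i * y + ev k t d)) => [|d]; last by rewrite ev_cons.
    rewrite prD pr_mulr; congr (_ * _ + _).
    by rewrite /v /ev star_sum; apply: eq_bigr => q _; rewrite starM kh.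
  have -> : pr t (ev k' t) = pr t (ev k t) - star v * g * v.
    rewrite (@eq_pr _ _ (fun d => ev k t d - k d i * (g * v))) => [|d].
      rewrite prB pr_mulr -!mulrA; congr (_ - _ * _).
      by rewrite /v /ev star_sum; apply: eq_bigr => q _; rewrite starM kh.
    rewrite /v /ev !mulr_sumr -sumrB; apply: eq_bigr => q _.
    by rewrite mulrBl !mulrA.
  have -> : star (y + g * v) = star y + star v * g by rewrite starD starM sg.
  have -> : (star y + star v * g) * (k i i + sc e) * (y + g * v) =
     star y * (k i i + sc e) * y + star y * ((k i i + sc e) * g) * v
     + star v * (g * (k i i + sc e)) * y + star v * (g * (k i i + sc e)) * g * v by ncring.
  rewrite hg gh.
  have -> : sc e * (star y * y) = star y * sc e * y by rewrite mulrA scC.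
  ncring.
rewrite expand; apply: posD.
  apply: pos_conj; apply: posD => //; exact: pos_sc (ltW e0).
apply: IH.
- by move=> a b; rewrite starB !starM sg !kh mulrA.
- move=> a b; apply: subD => //; rewrite -scaleN1r; apply: subZ.
  by apply: subM => //; exact: subM.
(* This coefficient annihilates the completed square, so the Schur complement on [t] equals the
   shifted form at [(i, y) :: t]; [y] lies in [B] because [g] does. *)
- move=> t Bt; pose y := - (g * ev k t i).
  have := expand y t; rewrite /y addNr mulr0 add0r => <-.
  apply: posD; last by apply: pos_scM; [exact: ltW | exact: pos_star_mul].
  apply: kp; split => //=; rewrite -scaleN1r; apply: subZ; apply: subM => //.
  exact: ev_in.
Qed.

End Lists.

(** * Completion of a positive kernel *)

Section KernelModule.
Context (T : Type) (k : T -> T -> A).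
Context (kh : forall i j, star (k i j) = k j i).
Context (kp : forall s, pos (pr s (ev k s))).
Implicit Types (s t : seq (T * A)) (f g : T -> A) (C D e : R).

Notation ev := (ev k).

Definition sn s : R := Num.sqrt (nrm (pr s (ev s))).
Lemma sn_ge0 s : 0 <= sn s. Proof. exact: sqrtr_ge0. Qed.
Lemma sn_sqr s : sn s * sn s = nrm (pr s (ev s)).
Proof. by rewrite -expr2 sqr_sqrtr // nrm_ge0. Qed.

Lemma pr_ev_le s t : nrm (pr s (ev t)) <= sn s * sn t.
Proof.
rewrite -(@ler_pXn2r _ 2) ?nnegrE ?nrm_ge0 ?mulr_ge0 ?sn_ge0 //.
rewrite exprMn !expr2 !sn_sqr -expr2; apply: cauchy_schwarz => // c.
have := kp (smul s c ++ t).
rewrite pr_cat !pr_smul !(@eq_pr _ _ (ev (_ ++ _)) _ (ev_cat k _ _)) !prD.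
rewrite !(@eq_pr _ _ (ev (smul _ _)) _ (ev_smul k _ _)) !pr_mulr.
by rewrite -(pr_ev_star s t kh) mulrDr !mulrA addrA.
Qed.

(** [C] bounds the functional [pr _ f] on formal sums. A relation rather than a norm, because an
    arbitrary [f] may admit no bound. *)
Definition bnd f C : Prop := 0 <= C /\ forall s, nrm (pr s f) <= C * sn s.

Lemma bnd_ev s : bnd (ev s) (sn s).
Proof. by split; [exact: sn_ge0 | move=> t; rewrite mulrC; exact: pr_ev_le]. Qed.

(** Tested on [s] itself; with [bnd_ev] this identifies the dual norm of [ev s] with [sn s]. *)
Lemma sn_le s C : bnd (ev s) C -> sn s <= C.
Proof.
move=> [C0 /(_ s)]; rewrite -sn_sqr; have := sn_ge0 s.
rewrite le_eqVlt => /orP[/eqP <- //|s0]; by rewrite ler_pM2r.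
Qed.

Lemma bnd_le f C D : C <= D -> bnd f C -> bnd f D.
Proof.
move=> CD [C0 h]; split; first exact: le_trans CD.
by move=> s; apply: le_trans (h s) _; rewrite ler_wpM2r ?sn_ge0.
Qed.

Lemma eq_bnd f g C : f =1 g -> bnd f C -> bnd g C.
Proof. by move=> /funext ->. Qed.

Lemma bndD f g C D : bnd f C -> bnd g D -> bnd (f + g) (C + D).
Proof.
move=> [C0 hf] [D0 hg]; split; first exact: addr_ge0.
move=> s; rewrite (prD s f g); apply: le_trans (nrmD _ _) _.
by rewrite mulrDl lerD.
Qed.

Lemma bnd_mulr f C b : bnd f C -> bnd (fun d => f d * b) (C * nrm b).
Proof.
move=> [C0 hf]; split; first by rewrite mulr_ge0 ?nrm_ge0.
move=> s; rewrite pr_mulr; apply: le_trans (nrmM _ _) _.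
by rewrite mulrAC ler_wpM2r ?nrm_ge0.
Qed.

Lemma bndN f C : bnd f C -> bnd (- f) C.
Proof.
move/(@bnd_mulr _ _ (-1)); rewrite nrmN nrm1 mulr1; apply: eq_bnd => d.
by rewrite mulrN1.
Qed.

Lemma bnd_sym f g C : bnd (f - g) C -> bnd (g - f) C.
Proof. by move/bndN; rewrite opprB. Qed.

Lemma bnd_tri f g h C D : bnd (f - g) C -> bnd (g - h) D -> bnd (f - h) (C + D).
Proof. by move=> h1 /(bndD h1); rewrite addrA subrK. Qed.

(* The distance from [f] to [ev s] is measured in the dual norm, which makes sense
   for every [f]; hence the completion is a subspace of a function space. *)
Definition inM f : Prop := forall e, 0 < e -> exists s, bnd (f - ev s) e.

Lemma inM_ev s : inM (ev s).
Proof.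
move=> e e0; exists s; rewrite subrr; split; first exact: ltW.
move=> t; rewrite /pr big1 ?nrm0 ?mulr_ge0 ?sn_ge0 ?(ltW e0) // => q _.
exact: mulr0.
Qed.

Lemma inM0 : inM 0.
Proof.
have -> : (0 : T -> A) = ev [::] by apply/funext => d; rewrite ev_nil.
exact: inM_ev.
Qed.

Lemma inMD f g : inM f -> inM g -> inM (f + g).
Proof.
move=> hf hg e e0; have [s hs] := hf (e / 2) ltac:(lra).
have [t ht] := hg (e / 2) ltac:(lra); exists (s ++ t).
have -> : f + g - ev (s ++ t) = (f - ev s) + (g - ev t).
  have -> : ev (s ++ t) = ev s + ev t by apply/funext => d; exact: ev_cat.
  by rewrite opprD addrACA.
by rewrite [e]splitr; exact: bndD.
Qed.

Lemma inM_mulr f b : inM f -> inM (fun d => f d * b).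
Proof.
move=> hf e e0; have b0 : 0 < nrm b + 1 by rewrite ltr_wpDl ?nrm_ge0.
have [s hs] := hf (e / (nrm b + 1)) (divr_gt0 e0 b0); exists (smul s b).
apply: (@eq_bnd (fun d => (f - ev s) d * b)).
  by move=> d; rewrite [RHS](_ : _ = f d * b - ev (smul s b) d) // ev_smul -mulrBl.
apply: bnd_le (bnd_mulr b hs).
by rewrite mulrAC ler_pdivrMr // ler_pM2l //; lra.
Qed.

Lemma inMZ f (c : R[i]) : inM f -> inM (c *: f).
Proof.
move=> /(@inM_mulr _ c%:A); congr inM; apply/funext => d.
by rewrite -scalerAr mulr1.
Qed.

Lemma inM_bnd f : inM f -> exists C, bnd f C.
Proof.
move=> /(_ 1 ltr01) [s hs]; exists (1 + sn s).
by rewrite -[f](subrK (ev s)); apply: bndD => //; exact: bnd_ev.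
Qed.

Lemma pr_le s f C : bnd f C -> nrm (pr s f) <= C * sn s.
Proof. by case. Qed.

Lemma pr_near f g s t C D D' : bnd g C -> bnd (f - ev s) D -> bnd (f - ev t) D' ->
  nrm (pr s g - pr t g) <= C * (D + D').
Proof.
move=> bg bs bt.
have -> : pr s g - pr t g = pr (s ++ smul t (-1)) g.
  by rewrite pr_cat pr_smul starN star1 mulN1r.
have C0 : 0 <= C by case: bg.
apply: le_trans (pr_le _ bg) _; rewrite ler_wpM2l //; apply: sn_le.
have -> : ev (s ++ smul t (-1)) = ev s - ev t.
  by apply/funext => d; rewrite ev_cat ev_smul mulrN1.
by apply: bnd_tri bt; exact: bnd_sym.
Qed.

(** The limit of [pr s g] as [ev s] tends to [f], characterised by its error estimate over all
    approximants, so that no approximating sequence has to be chosen or carried along. *)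
Definition is_ip f g (c : A) : Prop :=
  forall s C D, bnd g C -> bnd (f - ev s) D -> nrm (c - pr s g) <= C * D.

Lemma is_ip_exists f g : inM f -> (exists C, bnd g C) -> exists c, is_ip f g c.
Proof.
move=> Mf [C bg]; have C0 : 0 <= C by case: bg.
have [u hu] : exists u : nat -> seq (T * A), forall n, bnd (f - ev (u n)) n.+1%:R^-1.
  have h n : exists s, bnd (f - ev s) n.+1%:R^-1 by apply: Mf; rewrite invr_gt0 ltr0n.
  by exists (fun n => projT1 (cid (h n))) => n; exact: (projT2 (cid (h n))).
have small e : 0 < e -> exists N, forall n, (N <= n)%N -> C * n.+1%:R^-1 < e.
  move=> e0; have Ce : 0 <= C / e by rewrite divr_ge0 // ltW.
  exists (Num.bound (C / e)) => n hn; rewrite ltr_pdivrMr ?ltr0n // mulrC -ltr_pdivrMr //.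
  by apply: lt_le_trans (archi_boundP Ce) _; rewrite ler_nat; exact: leqW.
have cau : forall e, 0 < e -> exists N : nat, forall i j : nat,
        (N <= i)%N -> (N <= j)%N -> nrm (pr (u i) g - pr (u j) g) < e.
  move=> e e0; have [N hN] := small (e / 2) ltac:(lra); exists N => i j Ni Nj.
  apply: le_lt_trans (pr_near bg (hu i) (hu j)) _; rewrite mulrDr.
  by rewrite [e]splitr; apply: ltrD; exact: hN.
have [c hc] := nrm_complete cau; exists c => s C' D bg' bs.
apply: (@le_eps _ _ _ (1 + C')) => e e0 _; have [N hN] := hc e e0.
have e'0 : 0 <= e^-1 by rewrite invr_ge0 ltW.
pose n := maxn N (Num.bound e^-1).
have h1 := hN n (leq_maxl _ _).
have h2 := pr_near bg' (hu n) bs.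
have h3 : n.+1%:R^-1 <= e.
  rewrite invf_ple ?posrE ?ltr0n //; apply: ltW; apply: lt_le_trans (archi_boundP e'0) _.
  by rewrite ler_nat leqW // leq_maxr.
have h4 := nrm_tri (pr (u n) g) c (pr s g).
rewrite nrmC in h1.
have C'0 : 0 <= C' by case: bg'.
have h5 : C' * n.+1%:R^-1 <= C' * e by rewrite ler_wpM2l.
rewrite mulrDr in h2; move: (C' * n.+1%:R^-1) h2 h5 => w h2 h5.
by lra.
Qed.

Definition ipA f g : A := xget 0 (is_ip f g).

Lemma ipA_is_ip f g : inM f -> inM g -> is_ip f g (ipA f g).
Proof.
move=> Mf Mg; have [c hc] := is_ip_exists Mf (inM_bnd Mg).
exact: (xgetPex 0 (ex_intro _ c hc)).
Qed.

Lemma ipA_near f g s t C D e e' : inM f -> inM g -> bnd f C -> bnd g D ->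
  bnd (f - ev s) e -> bnd (g - ev t) e' ->
  nrm (ipA f g - pr s (ev t)) <= D * e + e' * (C + e).
Proof.
move=> Mf Mg bf bg bs bt; apply: le_trans (nrm_tri (pr s g) _ _) _.
apply: lerD; first exact: (ipA_is_ip Mf Mg bg bs).
rewrite -(prB s g (ev t)); have e0 : 0 <= e' by case: bt.
apply: le_trans (pr_le s bt) _; rewrite ler_wpM2l //; apply: sn_le.
by rewrite -[ev s](subrK f) addrC; apply: bndD => //; exact: bnd_sym.
Qed.

Lemma ipA_uniq f g c : inM f -> inM g -> (exists D, forall e, 0 < e -> e <= 1 ->
  exists2 s, bnd (f - ev s) e & nrm (c - pr s g) <= e * D) -> ipA f g = c.
Proof.
move=> Mf Mg [D h]; have [C bg] := inM_bnd Mg.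
apply/eqP; rewrite -subr_eq0; apply/eqP; apply: (@nrm_eps _ (C + D)) => e e0 e1.
have [s bs hs] := h e e0 e1.
apply: le_trans (nrm_tri (pr s g) _ _) _; rewrite [X in _ + X]nrmC.
by rewrite mulrDr; apply: lerD => //; rewrite mulrC; exact: (ipA_is_ip Mf Mg bg bs).
Qed.

Lemma ipA_evl s g : inM g -> ipA (ev s) g = pr s g.
Proof.
move=> Mg; apply: ipA_uniq => //; first exact: inM_ev.
exists 0 => e e0 _; exists s; last by rewrite subrr nrm0 mulr0.
rewrite subrr; apply: bnd_le (ltW e0) _; split => // t.
by rewrite /pr big1 ?nrm0 ?mul0r // => q _; exact: mulr0.
Qed.

Lemma ipADr f g h : inM f -> inM g -> inM h -> ipA f (g + h) = ipA f g + ipA f h.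
Proof.
move=> Mf Mg Mh; have [C bg] := inM_bnd Mg; have [D bh] := inM_bnd Mh.
apply: ipA_uniq => //; first exact: inMD.
exists (C + D) => e e0 _; have [s bs] := Mf e e0; exists s => //.
rewrite (prD s g h) opprD addrACA; apply: le_trans (nrmD _ _) _.
by rewrite mulrC mulrDl; apply: lerD; exact: (ipA_is_ip Mf _ _ bs).
Qed.

Lemma ipA_mulr f g b : inM f -> inM g -> ipA f (fun d => g d * b) = ipA f g * b.
Proof.
move=> Mf Mg; have [C bg] := inM_bnd Mg.
apply: ipA_uniq => //; first exact: inM_mulr.
exists (C * nrm b) => e e0 _; have [s bs] := Mf e e0; exists s => //.
rewrite pr_mulr -mulrBl; apply: le_trans (nrmM _ _) _.
rewrite mulrA [e * C]mulrC ler_wpM2r ?nrm_ge0 //; exact: (ipA_is_ip Mf Mg bg bs).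
Qed.

Lemma ipAZr f g (c : R[i]) : inM f -> inM g -> ipA f (c *: g) = c *: ipA f g.
Proof.
move=> Mf Mg; rewrite -[RHS]mulr1 -scalerAl scalerAr -ipA_mulr //; congr ipA.
by apply/funext => d; rewrite -scalerAr mulr1.
Qed.

Lemma ipA_star f g : inM f -> inM g -> ipA g f = star (ipA f g).
Proof.
move=> Mf Mg; have [C bf] := inM_bnd Mf; have [D bg] := inM_bnd Mg.
have [C0 D0] : 0 <= C /\ 0 <= D by case: bf; case: bg.
apply/eqP; rewrite -subr_eq0; apply/eqP.
apply: (@nrm_eps _ ((C + D + 1) *+ 2)) => e e0 e1.
have [s bs] := Mf e e0; have [t bt] := Mg e e0.
have h1 := ipA_near Mf Mg bf bg bs bt.
have h2 := ipA_near Mg Mf bg bf bt bs.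
apply: le_trans (nrm_tri (pr t (ev s)) _ _) _.
rewrite -(pr_ev_star s t kh) in h2 *; rewrite -starB nrm_star [X in _ + X]nrmC.
nra.
Qed.

Lemma ipA_pos f : inM f -> pos (ipA f f).
Proof.
move=> Mf; have [C bf] := inM_bnd Mf; have C0 : 0 <= C by case: bf.
apply: (@pos_closed _ (C + C + 1)) => e e0 e1.
have [s bs] := Mf e e0; exists (pr s (ev s)); first exact: kp.
by apply: le_trans (ipA_near Mf Mf bf bf bs bs) _; nra.
Qed.

Lemma ipA_le f C : inM f -> bnd f C -> nrm (ipA f f) <= C * C.
Proof.
move=> Mf bf; have C0 : 0 <= C by case: bf.
apply: (@le_eps _ _ _ (4 * C + 2)) => e e0 e1.
have [s bs] := Mf e e0; have h := ipA_near Mf Mf bf bf bs bs.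
have s1 : sn s <= C + e.
  by apply: sn_le; rewrite -[ev s](subrK f) addrC; apply: bndD => //; exact: bnd_sym.
have := nrm_tri (pr s (ev s)) (ipA f f) 0; rewrite !subr0 -sn_sqr.
have := sn_ge0 s; nra.
Qed.

(** With [ipA_le], the dual norm and the inner product norm agree on the module, so questions of
    convergence can be settled with [bnd]. *)
Lemma bnd_ipA f : inM f -> bnd f (Num.sqrt (nrm (ipA f f))).
Proof.
move=> Mf; have [C bf] := inM_bnd Mf; have C0 : 0 <= C by case: bf.
split=> [|t]; first exact: sqrtr_ge0.
rewrite -(@ler_pXn2r _ 2) ?nnegrE ?mulr_ge0 ?sqrtr_ge0 ?nrm_ge0 ?sn_ge0 //.
rewrite exprMn sqr_sqrtr ?nrm_ge0 //.
apply: (@le_eps _ _ _ (sn t ^+ 2 * (4 * C + 4))) => e e0 e1.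
have [s bs] := Mf e e0; have h := ipA_near Mf Mf bf bf bs bs.
have s1 : sn s <= C + e.
  by apply: sn_le; rewrite -[ev s](subrK f) addrC; apply: bndD => //; exact: bnd_sym.
have h1 := nrm_tri (ipA f f) (pr s (ev s)) 0; rewrite !subr0 -sn_sqr nrmC in h1.
have h2 : nrm (pr t f) <= (sn s + e) * sn t.
  have -> : f = ev s + (f - ev s) by rewrite addrC subrK.
  by apply: pr_le; apply: bndD => //; exact: bnd_ev.
apply: le_trans (_ : ((sn s + e) * sn t) ^+ 2 <= _).
  by rewrite lerXn2r ?nnegrE ?nrm_ge0 ?mulr_ge0 ?addr_ge0 ?sn_ge0 // ltW.
rewrite exprMn [_ ^+ 2 * sn t ^+ 2]mulrC [nrm _ * _]mulrC [e * _]mulrCA -mulrDr.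
rewrite ler_wpM2l ?exprn_ge0 ?sn_ge0 //.
by have := sn_ge0 s; nra.
Qed.

Lemma inM_lim f : (forall e, 0 < e -> exists2 g, inM g & bnd (f - g) e) -> inM f.
Proof.
move=> h e e0; have [g Mg bg] := h (e / 2) ltac:(lra).
have [s bs] := Mg (e / 2) ltac:(lra); exists s.
by rewrite [e]splitr; exact: bnd_tri bs.
Qed.

(** Reproducing property: [f d] is the pairing of [f] with [[:: (d, 1)]]. *)
Lemma bnd0_eq0 d f : bnd f 0 -> f d = 0.
Proof.
move=> [_ /(_ [:: (d, 1)])]; rewrite mul0r /pr big_seq1 /= star1 mul1r.
exact: nrm_le0.
Qed.

(** Point values are pairings, so pointwise limits exist. For a fixed list the pairing is a finite
    sum, and the Cauchy bound passes to the limit. *)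
Lemma bnd_complete (u : nat -> T -> A) :
  (forall e, 0 < e -> exists N, forall i j, (N <= i)%N -> (N <= j)%N -> bnd (u i - u j) e) ->
  exists f, forall e, 0 < e -> exists N, forall i, (N <= i)%N -> bnd (u i - f) e.
Proof.
move=> cau.
have lim d : exists l, cv (fun n => u n d) l.
  apply: nrm_complete => e e0; have s0 := sn_ge0 [:: (d, 1)].
  have [N hN] := cau (e / (sn [:: (d, 1)] + 1)) ltac:(apply: divr_gt0; lra).
  exists N => i j Ni Nj; have [_ /(_ [:: (d, 1)])] := hN i j Ni Nj.
  rewrite /pr big_seq1 /= star1 mul1r => /le_lt_trans; apply.
  by rewrite mulrAC ltr_pdivrMr ?ltr_wpDl // ltr_pM2l //; lra.
pose f d := projT1 (cid (lim d)); exists f => e e0; have [N hN] := cau e e0.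
exists N => i Ni; split; first exact: ltW.
move=> s; suff [D hD] : exists D, forall e', 0 < e' -> exists2 j, (N <= j)%N &
    nrm (pr s (u j - f)) <= e' * D.
  apply: (@le_eps _ _ _ D) => e' e'0 _; have [j Nj h] := hD e' e'0.
  have -> : pr s (u i - f) = pr s (u i - u j) + pr s (u j - f).
    by rewrite -prD; apply: eq_pr => d; rewrite -[RHS]/((u i - u j + (u j - f)) d) addrA subrK.
  apply: le_trans (nrmD _ _) _; apply: lerD => //.
  by case: (hN i j Ni Nj).
have [D hD] : exists D, forall e', 0 < e' -> exists M, forall j, (M <= j)%N ->
    nrm (pr s (u j - f)) <= e' * D.
  elim: s => [|q s [D hD]].
    by exists 0 => e' _; exists 0%N => j _; rewrite /pr big_nil nrm0 mulr0.
  exists (nrm q.2 + D) => e' e'0; have [M1 h1] := hD e' e'0.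
  have [M2 h2] := projT2 (cid (lim q.1)) e' e'0.
  exists (maxn M1 M2) => j; rewrite geq_max => /andP[j1 j2].
  rewrite pr_cons [leRHS]mulrDr; apply: le_trans (nrmD _ _) _; apply: lerD; last exact: h1.
  apply: le_trans (nrmM _ _) _; rewrite nrm_star [leRHS]mulrC ler_wpM2l ?nrm_ge0 //.
  exact: ltW (h2 _ j2).
exists D => e' e'0; have [M hM] := hD e' e'0.
by exists (maxn N M); [exact: leq_maxl | apply: hM; exact: leq_maxr].
Qed.

End KernelModule.

(** * The dilation *)

Definition ker_exp (a b : A) : A := E (star a * b).

Lemma ker_exp_star a b : star (ker_exp a b) = ker_exp b a.
Proof. by rewrite -exp_star starM starK. Qed.

Lemma ker_exp_pos s : pos (pr s (ev ker_exp s)).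
Proof.
apply: kernel_pos; [exact: ker_exp_star | move=> *; exact: exp_in |].
move=> t Bt; set y := \sum_(q <- t) q.1 * q.2.
suff -> : pr t (ev ker_exp t) = E (star y * y) by apply: exp_pos; exact: pos_star_mul.
have evE : forall d, ev ker_exp t d = E (star d * y).
  move=> d; rewrite /y /ev; elim: t Bt {y} => [|q t IH] /=; first by rewrite !big_nil mulr0 exp0.
  by move=> [Bq Bt]; rewrite !big_cons mulrDr expD mulrA exp_mulr // IH.
have prE : forall z, pr t (fun d => E (star d * z)) = E (star y * z).
  move=> z; rewrite /y /pr; elim: t Bt {y evE} => [|q t IH] /=.
    by rewrite !big_nil star0 mul0r exp0.
  move=> [Bq Bt]; rewrite !big_cons starD starM mulrDl expD -mulrA [E (star q.2 * _)]exp_mull ?IH //.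
  exact: sub_star.
by rewrite (eq_pr t evE) prE.
Qed.

Local Notation evE := (ev ker_exp).
Local Notation sE := (sn ker_exp).
Local Notation inME := (inM ker_exp).
Local Notation ipE := (ipA ker_exp).
Local Notation bndE := (bnd ker_exp).
Let kh := ker_exp_star.
Let kp := ker_exp_pos.

(** * Left multiplication on the first factor *)

Definition lact (c : A) (s : seq (A * A)) : seq (A * A) := [seq (c * q.1, q.2) | q <- s].

Lemma pr_lact c s f : pr (lact c s) f = pr s (fun d => f (c * d)).
Proof. by rewrite /pr big_map. Qed.

(** Left multiplication by [c] becomes precomposition with c^*, which extends it from formal sums to
    all functions. *)
Lemma ev_lact c s d : evE (lact c s) d = evE s (star c * d).
Proof.
rewrite /ev big_map; apply: eq_bigr => q _ /=.
by rewrite /ker_exp starM starK mulrA.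
Qed.

Lemma ev_lactD c c' s d : evE (lact (c + c') s) d = evE (lact c s) d + evE (lact c' s) d.
Proof.
rewrite /ev !big_map -big_split; apply: eq_bigr => q _ /=.
by rewrite /ker_exp mulrDl mulrDr expD mulrDl.
Qed.

Lemma ev_lact_sc t s d : evE (lact (sc t) s) d = sc t * evE s d.
Proof.
rewrite /ev big_map mulr_sumr; apply: eq_bigr => q _ /=.
by rewrite /ker_exp mulrA -[star d * _]scC -mulrA exp_sc mulrA.
Qed.

(** With r^2 = |c|^2 - c^* c, the difference |c|^2 <s, s> - <c s, c s> equals <r s, r s>, which is
    positive. *)
Lemma sn_lact c s : sE (lact c s) <= nrm c * sE s.
Proof.
rewrite -(@ler_pXn2r _ 2) ?nnegrE ?mulr_ge0 ?sn_ge0 ?nrm_ge0 //.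
rewrite exprMn ![sE _ ^+ 2]expr2 !sn_sqr.
have key a : pr (lact a s) (evE (lact a s)) = pr s (evE (lact (star a * a) s)).
  rewrite pr_lact; apply: eq_pr => d; rewrite !ev_lact; congr (evE s _).
  by rewrite starM starK mulrA.
have [r [pr' rr _]] : exists r, [/\ pos r, r * r = sc (nrm c ^+ 2) - star c * c &
    forall P, closed_subalg P -> P (sc (nrm c ^+ 2) - star c * c) -> P r].
  by apply: pos_sqrt; apply: pos_scB; rewrite ?nrm_cstar // starM starK.
have h : pr s (evE s) * sc (nrm c ^+ 2) - pr (lact c s) (evE (lact c s)) =
    pr (lact r s) (evE (lact r s)).
  rewrite !key (pos_sa pr') rr -pr_mulr -prB; apply: eq_pr => d.
  rewrite -[evE (lact (sc _ - _) s) d](addrK (evE (lact (star c * c) s) d)).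
  by rewrite -ev_lactD subrK ev_lact_sc scC.
have := @norm_mono (pr (lact c s) (evE (lact c s))) (pr s (evE s) * sc (nrm c ^+ 2)) (kp _).
rewrite h -scC nrm_scM ger0_norm ?exprn_ge0 ?nrm_ge0 //; apply; exact: kp.
Qed.

Lemma bnd_lact f C c : bndE f C -> bndE (fun d => f (c * d)) (C * nrm c).
Proof.
move=> [C0 h]; split; first by rewrite mulr_ge0 ?nrm_ge0.
move=> s; rewrite -pr_lact; apply: le_trans (h _) _.
by rewrite -mulrA ler_wpM2l // sn_lact.
Qed.

Lemma inM_lact f c : inME f -> inME (fun d => f (c * d)).
Proof.
move=> Mf e e0; have c0 : 0 < nrm c + 1 by rewrite ltr_wpDl ?nrm_ge0.
have [s hs] := Mf (e / (nrm c + 1)) (divr_gt0 e0 c0); exists (lact (star c) s).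
apply: (@eq_bnd _ _ (fun d => (f - evE s) (c * d))).
  by move=> d; rewrite [RHS](_ : _ = f (c * d) - evE (lact (star c) s) d) // ev_lact starK.
apply: bnd_le (bnd_lact c hs).
by rewrite mulrAC ler_pdivrMr // ler_pM2l //; lra.
Qed.

Lemma ipA_lact f g c : inME f -> inME g ->
  ipE (fun d => f (star c * d)) g = ipE f (fun d => g (c * d)).
Proof.
move=> Mf Mg; have [C bg] := inM_bnd kh kp Mg.
have c0 : 0 < nrm c + 1 by rewrite ltr_wpDl ?nrm_ge0.
apply: ipA_uniq => //; first exact: inM_lact.
exists (C * nrm c + C) => e e0 e1.
have e2 : 0 < e / (nrm c + 1) by rewrite divr_gt0.
have [s bs] := Mf _ e2; exists (lact c s).
  apply: (@eq_bnd _ _ (fun d => (f - evE s) (star c * d))).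
    by move=> d; rewrite [RHS](_ : _ = f (star c * d) - evE (lact c s) d) // ev_lact.
  apply: bnd_le (bnd_lact (star c) bs).
  by rewrite nrm_star mulrAC ler_pdivrMr // ler_pM2l //; lra.
rewrite pr_lact.
apply: le_trans (ipA_is_ip kh kp Mf (inM_lact c Mg) (bnd_lact c bg) bs) _.
have C0 : 0 <= C by case: bg.
have h : e / (nrm c + 1) <= e by rewrite ler_pdivrMr // ler_peMr ?(ltW e0) // lerDr nrm_ge0.
apply: le_trans (_ : C * nrm c * e <= _).
  by rewrite ler_wpM2l // mulr_ge0 // nrm_ge0.
by rewrite mulrC mulrDr lerDl mulr_ge0 // ltW.
Qed.

(** * The module, the representation and the isometry *)

Fact inME_lin c f g : inME f -> inME g -> inME (c *: f + g).
Proof. by move=> Mf Mg; apply: inMD => //; exact: inMZ. Qed.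

Definition dilation := subspace (LinearSubspace (inM0 ker_exp) inME_lin).

Definition mk (f : A -> A) (Mf : inME f) : dilation :=
  @mk_subspace _ _ (LinearSubspace (inM0 ker_exp) inME_lin) f Mf.

Lemma dilationP (x : dilation) : inME (val x). Proof. exact: subspaceP x. Qed.

Definition dil_ract (x : dilation) (b : A) : dilation := mk (inM_mulr b (dilationP x)).
Definition dil_ip (x y : dilation) : A := E (ipE (val x) (val y)).
Definition dil_pi (a : A) (x : dilation) : dilation := mk (inM_lact (star a) (dilationP x)).
Definition dil_V (a : A) : dilation := mk (inM_ev ker_exp [:: (1, a)]).
(** Pairing with 1 (x) a gives a^* times the value at 1, so evaluation at 1 is the adjoint of
    [dil_V]. *)
Definition dil_Vs (x : dilation) : A := val x 1.

Lemma dil_ext (x y : dilation) : (forall d, val x d = val y d) -> x = y.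
Proof. by move=> h; apply/val_inj/funext. Qed.

Lemma dil_VE a d : val (dil_V a) d = E (star d) * a.
Proof. by rewrite /= /ev big_seq1 /= /ker_exp mulr1. Qed.

Local Notation hn := (hnorm nrm dil_ip).

Lemma hnorm_le x C : bndE (val x) C -> hn x <= C.
Proof.
move=> bx; have C0 : 0 <= C by case: bx.
rewrite -[leRHS](ger0_norm C0) -sqrtr_sqr expr2 /hnorm ler_sqrt ?mulr_ge0 //.
by apply: le_trans (exp_nrm _) _; apply: (ipA_le kh kp) => //; exact: dilationP.
Qed.

(** For the positive element p = <x, x> in [A], p <= K E p gives |p| <= K |E p|: the converse
    comparison to [hnorm_le]. *)
Lemma bnd_hnorm x : bndE (val x) (Num.sqrt K * hn x).
Proof.
apply: bnd_le (bnd_ipA kh kp (dilationP x)).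
have K0 : 0 <= K := le_trans ler01 K1.
rewrite /hnorm -sqrtrM // ler_sqrt ?mulr_ge0 ?nrm_ge0 //.
have pip := ipA_pos kh kp (dilationP x).
apply: le_trans (norm_mono pip (exp_pimsner_popa pip)) _.
by rewrite nrm_scM ger0_norm.
Qed.

Lemma dil_ipDr x y z : dil_ip x (y + z) = dil_ip x y + dil_ip x z.
Proof. by rewrite /dil_ip (ipADr kh kp) ?expD //; exact: dilationP. Qed.

Lemma dil_ipZr c x y : dil_ip x (c *: y) = c *: dil_ip x y.
Proof. by rewrite /dil_ip (ipAZr kh kp) ?expZ //; exact: dilationP. Qed.

Lemma dil_ip_star x y : dil_ip y x = star (dil_ip x y).
Proof. by rewrite /dil_ip (ipA_star kh kp) ?exp_star //; exact: dilationP. Qed.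

Lemma dil_ip_ract x y b : B b -> dil_ip x (dil_ract y b) = dil_ip x y * b.
Proof. by move=> Bb; rewrite /dil_ip (ipA_mulr kh kp) ?exp_mulr //; exact: dilationP. Qed.

Lemma dil_ip_pi a x y : dil_ip (dil_pi (star a) x) y = dil_ip x (dil_pi a y).
Proof.
by rewrite /dil_ip; congr E; apply: (ipA_lact (star a)); exact: dilationP.
Qed.

Lemma dil_ip_V a x : dil_ip (dil_V a) x = E (star a * dil_Vs x).
Proof.
by rewrite /dil_ip (ipA_evl kh kp) /pr ?big_seq1 //; exact: dilationP.
Qed.

Lemma dilation_complete : complete_wrt hn.
Proof.
move=> u cau; have K0 : 0 < Num.sqrt K by rewrite sqrtr_gt0 (lt_le_trans ltr01 K1).
have [e e0|f hf] := @bnd_complete _ ker_exp (fun n => val (u n)).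
  have [N hN] := cau (e / Num.sqrt K) (divr_gt0 e0 K0); exists N => i j Ni Nj.
  apply: bnd_le (bnd_hnorm (u i - u j)).
  by rewrite mulrC -ler_pdivlMr // ltW // hN.
have Mf : inME f.
  apply: inM_lim => e e0; have [N hN] := hf e e0; exists (val (u N)); first exact: dilationP.
  by apply: bnd_sym; exact: hN.
exists (mk Mf) => e e0; have [N hN] := hf (e / 2) ltac:(lra); exists N => i Ni.
have := @hnorm_le (u i - mk Mf) (e / 2) (hN i Ni); lra.
Qed.

Lemma dilation_hilbert : hilbert_module star nrm B dil_ract dil_ip.
Proof.
repeat split.
- by move=> x y b _; apply: dil_ext => d; exact: mulrDl.
- by move=> x b c _ _; apply: dil_ext => d; exact: mulrDr.
- by apply: dil_ext => d; rewrite /= -scalerAl.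
- by apply: dil_ext => d; rewrite /= -scalerAr.
- by move=> x b c _ _; apply: dil_ext => d; rewrite /= mulrA.
- by move=> x y; exact: exp_in.
- exact: dil_ipDr.
- exact: dil_ipZr.
- by move=> *; exact: dil_ip_ract.
- exact: dil_ip_star.
- move=> x; have [s [ps ss Ps]] := pos_sqrt (exp_pos (ipA_pos kh kp (dilationP x))).
  exists s; rewrite (pos_sa ps) ss; split => //.
  by apply: Ps; [exact: closed_subalg_sub | exact: exp_in].
- move=> x x0; apply: dil_ext => d; apply: (@bnd0_eq0 _ ker_exp).
  by have := bnd_hnorm x; rewrite /hnorm x0 nrm0 sqrtr0 mulr0.
- exact: dilation_complete.
Qed.

(** Linear relations among the kernel functions [evE] are inherited, conjugated, by the values of
    every element of the module. *)
Lemma pr_null s f : inME f -> (forall d, evE s d = 0) -> pr s f = 0.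
Proof.
move=> Mf s0; have [C bf] := inM_bnd kh kp Mf.
have sn0 : sE s = 0.
  by rewrite /sn (_ : pr s _ = 0) ?nrm0 ?sqrtr0 // /pr big1 // => q _; rewrite s0 mulr0.
by apply: nrm_le0; apply: le_trans (pr_le s bf) _; rewrite sn0 mulr0.
Qed.

(** [dil_pi] precomposes with [star a], so its additivity in [a] requires the elements of the module
    to be additive functions. *)
Lemma dilationD f x y : inME f -> f (x + y) = f x + f y.
Proof.
move=> Mf; apply/eqP; rewrite -subr_eq0; apply/eqP.
have := @pr_null [:: (x + y, 1); (x, -1); (y, -1)] f Mf.
rewrite !pr_cons /= pr_nil starN star1 addr0 !mulN1r mul1r opprD => -> // d.
by rewrite !ev_cons ev_nil /= /ker_exp !mulrN1 mulr1 mulrDr expD addr0 -opprD subrr.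
Qed.

Lemma dilationZ f c x : inME f -> f (c *: x) = conjc c *: f x.
Proof.
move=> Mf; apply/eqP; rewrite -subr_eq0; apply/eqP.
have := @pr_null [:: (c *: x, 1); (x, - c%:A)] f Mf.
rewrite !pr_cons /= pr_nil starN starZ star1 addr0 mulNr mul1r.
rewrite -scalerAl mul1r => -> // d.
rewrite !ev_cons ev_nil /= /ker_exp mulr1 mulrN -!scalerAr mulr1 expZ addr0.
exact: subrr.
Qed.

Lemma dilation_star_hom : star_hom_EndB star nrm B dil_ract dil_ip dil_pi.
Proof.
split; first move=> a; repeat split.
- by move=> *; exact: dil_ext.
- by move=> *; exact: dil_ext.
- by move=> *; exact: dil_ext.
- exists (Num.sqrt K * nrm a) => x; apply: hnorm_le.
  by rewrite -nrm_star mulrAC; apply: bnd_lact; exact: bnd_hnorm.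
- by move=> a b x; apply: dil_ext => d; rewrite /= starD mulrDl dilationD //; exact: dilationP.
- move=> c a x; apply: dil_ext => d.
  by rewrite /= starZ -scalerAl dilationZ ?conjcK //; exact: dilationP.
- by move=> a b x; apply: dil_ext => d /=; rewrite starM mulrA.
- exact: dil_ip_pi.
Qed.

Lemma dilation_isometry :
  partial_isometry_from_A star nrm B E dil_ract dil_ip dil_V dil_Vs.
Proof.
repeat split.
- move=> a b; apply: dil_ext => d.
  by rewrite [RHS](_ : _ = val (dil_V a) d + val (dil_V b) d) // !dil_VE mulrDr.
- move=> c a; apply: dil_ext => d.
  by rewrite [RHS](_ : _ = c *: val (dil_V a) d) // !dil_VE scalerAr.
- by move=> a b _; apply: dil_ext => d; rewrite [RHS](_ : _ = val (dil_V a) d * b) // !dil_VE mulrA.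
- exists 1 => a; rewrite mul1r /hnorm dil_ip_V.
  by rewrite /dil_Vs dil_VE star1 exp1 mul1r.
- exact: dil_ip_V.
(* Since E 1 = 1, [dil_Vs] is a left inverse of [dil_V], which is therefore an isometry. *)
- by move=> a; congr dil_V; rewrite /dil_Vs dil_VE star1 exp1 mul1r.
Qed.

Lemma dilation_exp a x : E a * x = dil_Vs (dil_pi a (dil_V x)).
Proof. by rewrite /dil_Vs [RHS]dil_VE mulr1 starK. Qed.

Lemma dilation_dense (m : dilation) (e : R) : 0 < e ->
  exists (n : nat) (c : 'I_n -> R[i]) (a1 a2 : 'I_n -> A),
    hn (m - \sum_(i < n) c i *: dil_pi (a1 i) (dil_V (a2 i))) < e.
Proof.
move=> e0; have [s hs] := dilationP m (divr_gt0 e0 (ltr0n _ 2)).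
pose q (i : 'I_(size s)) := nth (0, 0) s i.
(* An entry (a, x) of the list represents pi a (V x); its coefficient is already contained in x. *)
exists (size s), (fun _ => 1), (fun i => (q i).1), (fun i => (q i).2).
apply: le_lt_trans (_ : e / 2 < e); last by lra.
apply: hnorm_le; apply: eq_bnd hs => d.
rewrite [RHS](_ : _ = val m d -
  val (\sum_(i < size s) 1 *: dil_pi (q i).1 (dil_V (q i).2)) d) //.
congr (val m d - _); rewrite raddf_sum fct_sumE /ev (big_nth (0, 0)) big_mkord.
apply: eq_bigr => i _; rewrite scale1r.
by rewrite [RHS]dil_VE starM starK.
Qed.

End CStar.

Theorem theorem3 (R : realType) (A : algType R[i]) (star : A -> A) (nrm : A -> R)
    (B : A -> Prop) (E : A -> A) (K : R) :
  cstar_algebra star nrm ->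
  cstar_subalgebra star nrm B ->
  cond_expectation nrm B E ->
  1 <= K ->
  (forall a, positive star a -> positive star ((K%:C)%C *: E a - a)) ->
  exists (M : lmodType R[i]) (ract : M -> A -> M) (ip : M -> M -> A)
         (pi : A -> M -> M) (V : A -> M) (Vs : M -> A),
    [/\ hilbert_module star nrm B ract ip,
        star_hom_EndB star nrm B ract ip pi,
        partial_isometry_from_A star nrm B E ract ip V Vs,
        (forall a x, E a * x = Vs (pi a (V x))) &
        (forall (m : M) (eps : R), 0 < eps ->
           exists (n : nat) (c : 'I_n -> R[i]) (a1 a2 : 'I_n -> A),
             hnorm nrm ip (m - \sum_(i < n) c i *: pi (a1 i) (V (a2 i))) < eps)].
Proof.
move=> HA HB HE K1 HK.
exists (dilation HA E), (@dil_ract _ _ _ _ HA E), (@dil_ip _ _ _ _ HA E),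
  (dil_pi HB HE K1 HK), (dil_V HA E), (@dil_Vs _ _ _ _ HA E).
split.
- exact: dilation_hilbert HB HE K1 HK.
- exact: dilation_star_hom.
- exact: dilation_isometry HB HE K1 HK.
- exact: dilation_exp.
- exact: dilation_dense.
Qed.
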